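(* Let $\mathcal{B}$ be a weakly irreducible $Z$-tensor of order $k$ and dimension $n$, and let $\lambda$ be the least H-eigenvalue of $\mathcal{B}$. Then $$\mathrm{am}(\lambda)\ge|\mathbb{V}_\lambda(\mathcal{B})|,$$ where $|\mathbb{V}_\lambda(\mathcal{B})|$ is the number of points of the projective eigenvariety of $\mathcal{B}$ associated with $\lambda$. Moreover, the Hu-Ye Conjecture holds for the eigenvalue $\lambda$ of $\mathcal{B}$, i.e., if $V_1,\ldots,V_\kappa$ are all the irreducible components of the affine eigenvariety $\mathcal{V}_\lambda(\mathcal{B})$, then $$\mathrm{am}(\lambda)\ge\sum_{i=1}^{\kappa}\dim(V_i)(k-1)^{\dim(V_i)-1},$$ and in particular $\mathrm{am}(\lambda)\ge \mathrm{gm}(\lambda)(k-1)^{\mathrm{gm}(\lambda)-1}$.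
   Context: Let $[n]=\{1,\ldots,n\}$. A tensor $\mathcal{B}=(b_{i_1\ldots i_k})$ of order $k\ge 2$ and dimension $n$ is an array of entries $b_{i_1\ldots i_k}\in\mathbb{C}$, $i_1,\ldots,i_k\in[n]$. For $x\in\mathbb{C}^n$, $\mathcal{B}x^{k-1}\in\mathbb{C}^n$ is given by $(\mathcal{B}x^{k-1})_i=\sum_{i_2,\ldots,i_k\in[n]}b_{ii_2\ldots i_k}x_{i_2}\cdots x_{i_k}$, and $x^{[k-1]}=(x_1^{k-1},\ldots,x_n^{k-1})$. A number $\lambda\in\mathbb{C}$ is an eigenvalue of $\mathcal{B}$ if $\mathcal{B}x^{k-1}=\lambda x^{[k-1]}$ for some $x\in\mathbb{C}^n\setminus\{0\}$ (an eigenvector). An eigenvalue is an H-eigenvalue if it has a real eigenvector. The characteristic polynomial $\varphi_{\mathcal{B}}(\lambda)$ is the (multivariate homogeneous) resultant $\mathrm{Res}(F_1,\ldots,F_n)$ of the $n$ homogeneous polynomials $F_i=\lambda x_i^{k-1}-(\mathcal{B}x^{k-1})_i$ of degree $k-1$ in $x_1,\ldots,x_n$. The algebraic multiplicity $\mathrm{am}(\lambda)$ is the multiplicity of $\lambda$ as a root of $\varphi_{\mathcal{B}}$. The affine eigenvariety is $\mathcal{V}_\lambda(\mathcal{B})=\{x\in\mathbb{C}^n:\mathcal{B}x^{k-1}=\lambda x^{[k-1]}\}$; the geometric multiplicity $\mathrm{gm}(\lambda)$ is the dimension of $\mathcal{V}_\lambda(\mathcal{B})$. The projective eigenvariety is $\mathbb{V}_\lambda(\mathcal{B})=\{x\in\mathbb{P}^{n-1}:\mathcal{B}x^{k-1}=\lambda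 x^{[k-1]}\}$, where $\mathbb{P}^{n-1}$ is complex projective space. A real tensor $\mathcal{B}$ is a $Z$-tensor if all its off-diagonal entries (those whose indices are not all equal) are non-positive; equivalently $\mathcal{B}=s\mathcal{I}-\mathcal{A}$ with $s>0$ and $\mathcal{A}$ a tensor with nonnegative entries, where $\mathcal{I}$ is the identity tensor (entries $1$ when all indices are equal and $0$ otherwise). The least H-eigenvalue of such a $\mathcal{B}$ is $s-\rho(\mathcal{A})$, where $\rho(\mathcal{A})$ is the spectral radius of $\mathcal A$ (largest modulus of its eigenvalues). The directed graph $D(\mathcal{B})$ has vertices $1,\ldots,n$ and an arc $(i,j)$ if and only if there is a nonzero entry $b_{ii_2\ldots i_k}$ with $j\in\{i_2,\ldots,i_k\}$. The tensor $\mathcal{B}$ is weakly irreducible if $D(\mathcal{B})$ is strongly connected. *)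

(* Defs.v *)
From mathcomp Require Import all_boot all_order all_algebra.
From mathcomp Require Import complex.
From mathcomp Require Import boolp classical_sets functions cardinality reals.
From mathcomp Require Import mpoly.

Set Implicit Arguments.
Unset Strict Implicit.
Unset Printing Implicit Defensive.

Import Order.TTheory GRing.Theory Num.Theory.

Local Open Scope classical_set_scope.
Local Open Scope ring_scope.

(** * Tensors *)

(* The entry b_{i i_2 ... i_k} of B is [B i t] with t = (i_2, ..., i_k).      *)
Definition tensor (K : Type) (k n : nat) : Type :=
  'I_n -> k.-1.-tuple 'I_n -> K.

Section Tensors.
Variables (K : comNzRingType) (k n : nat).
Implicit Types (B : tensor K k n) (lambda : K) (x : 'rV[K]_n).

(* B x^{k-1} *)
Definition tensor_app B x : 'rV[K]_n :=
  \row_i \sum_(t : k.-1.-tuple 'I_n) B i t * \prod_(j <- t) x 0 j.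

(* x^{[k-1]} *)
Definition vec_pow x : 'rV[K]_n := \row_i x 0 i ^+ k.-1.

Definition eigen_eq B lambda x : Prop :=
  tensor_app B x = lambda *: vec_pow x.

Definition affine_eigenvariety B lambda : set 'rV[K]_n :=
  [set x | eigen_eq B lambda x].

Definition tensor_arc B : rel 'I_n :=
  fun i j => [exists t : k.-1.-tuple 'I_n, (B i t != 0) && (j \in t)].

Definition weakly_irreducible B : Prop :=
  forall i j : 'I_n, connect (tensor_arc B) i j.

End Tensors.

(* A point of P^{n-1} is a line through the origin of K^n.                    *)
Definition proj_eigenvariety (K : fieldType) (k n : nat) (B : tensor K k n)
    (lambda : K) : set {vspace 'rV[K]_n} :=
  [set <[x]>%VS | x in affine_eigenvariety B lambda `\ 0].

Definition Z_tensor (R : realType) (k n : nat) (B : tensor R k n) : Prop :=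
  forall (i : 'I_n) (t : k.-1.-tuple 'I_n),
    ~~ all (pred1 i) t -> B i t <= 0.

Definition complex_tensor (R : realType) (k n : nat) (B : tensor R k n) :
    tensor R[i] k n :=
  fun i t => (B i t)%:C%C.

Definition H_eigenvalue (R : realType) (k n : nat) (B : tensor R[i] k n)
    (lambda : R[i]) : Prop :=
  exists2 x : 'rV[R]_n, x != 0 & eigen_eq B lambda (map_mx (real_complex R) x).

(* On R[i], z <= w means that w - z is a nonnegative real; the H-eigenvalues
   of a real tensor are real, so this is the usual order on them.             *)
Definition least_H_eigenvalue (R : realType) (k n : nat) (B : tensor R[i] k n)
    (lambda : R[i]) : Prop :=
  H_eigenvalue B lambda /\ forall mu : R[i], H_eigenvalue B mu -> lambda <= mu.

(** * Resultant and characteristic polynomial *)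

(* Number of coefficients of a system of n forms of degree d in n variables:
   one for each pair (form, monomial of degree d).                            *)
Definition nb_coef (n d : nat) : nat :=
  #|{: 'I_n * {m : 'X_{1..n < d.+1} | mdeg m == d}}|.

Definition coef_polynomial (C : closedFieldType) (n d : nat) : Type :=
  {mpoly C[nb_coef n d]}.

Definition coef_at (A : comNzRingType) (n d : nat) (F : 'I_n -> {mpoly A[n]})
    (j : 'I_(nb_coef n d)) : A :=
  let u := enum_val j in (F u.1)@_(\val u.2).

Definition irreducible_mpoly (K : fieldType) (N : nat) (p : {mpoly K[N]}) :
    Prop :=
  [/\ p != 0, p \isn't a GRing.unit &
      forall q r : {mpoly K[N]}, p = q * r ->
        q \is a GRing.unit \/ r \is a GRing.unit].

(* The resultant of n forms of degree d in n variables is the unique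
   irreducible polynomial in their coefficients that vanishes exactly on the
   systems with a nontrivial common zero and takes the value 1 at
   (x_1^d, ..., x_n^d).                                                       *)
Definition is_resultant (C : closedFieldType) (n d : nat)
    (Res : coef_polynomial C n d) : Prop :=
  [/\ irreducible_mpoly Res,
      forall F : 'I_n -> {mpoly C[n]}, (forall i, F i \is d.-homog) ->
        Res.@[coef_at F] = 0 <->
        exists2 x : 'rV[C]_n, x != 0 & forall i, (F i).@[fun j => x 0 j] = 0
    & Res.@[coef_at (fun i : 'I_n => 'X_i ^+ d)] = 1].

(* F_i = lambda x_i^{k-1} - (B x^{k-1})_i, with lambda the variable 'X of
   {poly C}.                                                                  *)
Definition char_system (C : closedFieldType) (k n : nat) (B : tensor C k n)
    (i : 'I_n) : {mpoly {poly C}[n]} :=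
  'X *: 'X_i ^+ k.-1
  - \sum_(t : k.-1.-tuple 'I_n) (B i t)%:P *: \prod_(j <- t) 'X_j.

Definition char_tensor_poly (C : closedFieldType) (k n : nat)
    (Res : coef_polynomial C n k.-1) (B : tensor C k n) : {poly C} :=
  mmap polyC (coef_at (char_system B)) Res.

Definition alg_mult (C : closedFieldType) (k n : nat)
    (Res : coef_polynomial C n k.-1) (B : tensor C k n) (lambda : C) : nat :=
  mup lambda (char_tensor_poly Res B).

(** * Zariski topology, irreducible components and dimension *)

Section Zariski.
Variables (K : fieldType) (n : nat).
Implicit Types (V Z : set 'rV[K]_n).

Definition zero_locus (S : set {mpoly K[n]}) : set 'rV[K]_n :=
  [set x | forall p, S p -> p.@[fun j => x 0 j] = 0].

Definition Zariski_closed Z : Prop := exists S, Z = zero_locus S.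

Definition irreducible_closed Z : Prop :=
  [/\ Zariski_closed Z, Z !=set0 &
      forall Z1 Z2, Zariski_closed Z1 -> Zariski_closed Z2 ->
        Z `<=` Z1 `|` Z2 -> Z `<=` Z1 \/ Z `<=` Z2].

Definition irreducible_component V Z : Prop :=
  [/\ irreducible_closed Z, Z `<=` V &
      forall Z', irreducible_closed Z' -> Z' `<=` V -> Z `<=` Z' -> Z' = Z].

(* a chain Z_0 < Z_1 < ... < Z_r of irreducible closed subsets of V *)
Definition has_chain V (r : nat) : Prop :=
  exists Z : nat -> set 'rV[K]_n,
    (forall i, (i <= r)%N -> irreducible_closed (Z i) /\ Z i `<=` V) /\
    (forall i, (i < r)%N -> Z i `<` Z i.+1).

(* the largest length of a chain (0 for the empty set) *)
Definition variety_dim V : nat :=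
  xget 0%N [set r | has_chain V r /\ forall s, has_chain V s -> (s <= r)%N].

End Zariski.

Definition geom_mult (K : fieldType) (k n : nat) (B : tensor K k n)
    (lambda : K) : nat :=
  variety_dim (affine_eigenvariety B lambda).

(* Main.v *)
(** Write B = sI - A with A >= 0 and let p > 0 be a Perron vector of A, so that
    lambda = s - rho(A).  Equality in the triangle inequality shows that every
    eigenvector x of B for lambda satisfies |x| = c p and that all the terms of
    (A x^{k-1})_i are aligned with x_i^{k-1}.  Hence the differential of
    F = lambda x^{[k-1]} - B x^{k-1} at x is, after rescaling by diagonal
    matrices, the Laplacian of a strongly connected weighted digraph: it has
    corank one and its image does not contain x^{[k-1]}.

    Consequently, for each of m distinct points x of the projective
    eigenvariety, the hypersurface Res = 0 has at F a branch whose tangent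
    hyperplane is transversal to the direction x^{[k-1]}; these hyperplanes are
    pairwise distinct, so the lowest homogeneous part of Res at F vanishes on m
    hyperplanes and has degree at least m.  Restricting to the pencil
    F + t x^{[k-1]} gives am(lambda) >= m.  In particular the projective
    eigenvariety is finite, the irreducible components of the affine one are
    lines, and all the dimensions involved are at most 1. *)
Require Import Defs.
From mathcomp Require Import all_boot all_order all_algebra.
From mathcomp Require Import complex.
From mathcomp Require Import boolp classical_sets functions cardinality reals.
From mathcomp Require Import ring lra zify.
From mathcomp Require topology normedtype derive realfun mpoly.

Set Implicit Arguments.
Unset Strict Implicit.
Unset Printing Implicit Defensive.

Import Order.TTheory GRing.Theory Num.Theory.

Local Open Scope classical_set_scope.
Local Open Scope ring_scope.

(** * The Perron eigenvector of a nonnegative weakly irreducible tensor *)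

Lemma prod_tuple_scale (K : comNzRingType) (m : nat) (I : Type)
    (t : m.-tuple I) (c : K) (f : I -> K) :
  \prod_(j <- t) (c * f j) = c ^+ m * \prod_(j <- t) f j.
Proof.
by rewrite big_split /= big_const_seq count_predT size_tuple iter_mulr_1.
Qed.

Lemma eq_prod_le (R : realFieldType) (I : eqType) (s : seq I) (f g : I -> R) :
  (forall j, 0 <= f j <= g j) -> (forall j, 0 < g j) ->
  \prod_(j <- s) f j = \prod_(j <- s) g j -> {in s, f =1 g}.
Proof.
move=> fg g_gt0; elim: s => [|a s IHs] // /eqP; rewrite !big_cons => /eqP e.
have /andP[fa0 fa] := fg a.
have le_s : \prod_(j <- s) f j <= \prod_(j <- s) g j by apply: ler_prod.
have gs0 : 0 < \prod_(j <- s) g j by apply: prodr_gt0.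
have efg : f a = g a.
  apply/eqP; rewrite eq_le fa leNgt; apply/negP => lt_a.
  have : f a * \prod_(j <- s) f j < g a * \prod_(j <- s) g j.
    by apply: (le_lt_trans (ler_wpM2l fa0 le_s)); rewrite ltr_pM2r.
  by rewrite e ltxx.
have es : \prod_(j <- s) f j = \prod_(j <- s) g j.
  by apply: (mulfI (lt0r_neq0 (g_gt0 a))); rewrite -e efg.
move=> j; rewrite inE => /orP[/eqP-> //|js].
exact: IHs.
Qed.

Lemma tensor_app_scale (K : comNzRingType) (k n : nat) (A : tensor K k n)
    (c : K) (y : 'rV[K]_n) :
  tensor_app A (c *: y) = c ^+ k.-1 *: tensor_app A y.
Proof.
apply/rowP => i; rewrite !mxE mulr_sumr; apply: eq_bigr => t _.
by under eq_bigr do rewrite mxE; rewrite prod_tuple_scale mulrCA.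
Qed.

Lemma connect_invariant (T : finType) (e : rel T) (P : T -> Prop) (x y : T) :
  connect e x y -> P x -> (forall a b, e a b -> P a -> P b) -> P y.
Proof.
move=> /connectP[s es ->] Px Pe; elim: s x es Px => [|a s IHs] x //=.
by move=> /andP[/Pe Pa /IHs]; move=> IH /Pa; exact: IH.
Qed.

Section Perron.
Variables (R : realType) (k n : nat) (A : tensor R k n).
Hypothesis A_ge0 : forall i t, 0 <= A i t.
Hypothesis A_irr : weakly_irreducible A.
Implicit Types (x y z p : 'rV[R]_n).

Lemma tensor_app_le y z i : (forall j, 0 <= y 0 j <= z 0 j) ->
  tensor_app A y 0 i <= tensor_app A z 0 i.
Proof.
move=> yz; rewrite !mxE; apply: ler_sum => t _.
by apply: ler_wpM2l => //; apply: ler_prod.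
Qed.

(** Every term of the sum is monotone in the vector, so equality of the sums forces equality term by
    term. For a nonzero entry the coefficient cancels, and [eq_prod_le] compares the remaining
    factors. *)
Lemma tensor_app_eq y z i : (forall j, 0 <= y 0 j <= z 0 j) ->
    (forall j, 0 < z 0 j) -> tensor_app A y 0 i = tensor_app A z 0 i ->
  forall j, tensor_arc A i j -> y 0 j = z 0 j.
Proof.
move=> yz z0; rewrite !mxE => e j /existsP[t /andP[At jt]].
have le_t (u : k.-1.-tuple 'I_n) :
    A i u * \prod_(l <- u) y 0 l <= A i u * \prod_(l <- u) z 0 l.
  by apply: ler_wpM2l => //; apply: ler_prod.
have eqt : A i t * \prod_(l <- t) y 0 l = A i t * \prod_(l <- t) z 0 l.
  apply/eqP; rewrite -subr_eq0 -oppr_eq0 opprB; apply/eqP.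
  apply: (psumr_eq0P (P := xpredT) (F := fun u : k.-1.-tuple 'I_n =>
    A i u * \prod_(l <- u) z 0 l - A i u * \prod_(l <- u) y 0 l)) => //.
    by move=> u _; rewrite subr_ge0.
  by rewrite sumrB e subrr.
exact: (eq_prod_le yz z0 (mulfI At eqt)).
Qed.

(* The bound is attained at an index maximising [y_i / p_i]; equality then
   propagates along the arcs of the digraph. *)
Lemma perron_comparison rho p nu y :
    (forall i, 0 < p 0 i) -> eigen_eq A rho p ->
    (forall i, 0 <= y 0 i) -> y != 0 ->
    (forall i, nu * y 0 i ^+ k.-1 <= tensor_app A y 0 i) ->
  nu <= rho /\ (nu = rho -> exists2 c, 0 < c & y = c *: p).
Proof.
move=> p0 Ap y0 yn0 nuy.
have /rV0Pn[i0 yi0] := yn0.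
have [i _ imax] := @arg_maxP _ R _ i0 xpredT (fun i => y 0 i / p 0 i) erefl.
set c := y 0 i / p 0 i in imax.
have {}imax j : y 0 j / p 0 j <= c by exact: imax.
have yi : y 0 i = (c *: p) 0 i by rewrite mxE divfK ?lt0r_neq0.
have c0 : 0 < c.
  apply: lt_le_trans (imax i0).
  by rewrite divr_gt0 // lt_def yi0 y0.
clearbody c.
have ycp j : 0 <= y 0 j <= (c *: p) 0 j.
  by rewrite y0 mxE -ler_pdivrMr ?imax.
have cp0 j : 0 < (c *: p) 0 j by rewrite mxE mulr_gt0.
have Acp j : tensor_app A (c *: p) 0 j = rho * (c *: p) 0 j ^+ k.-1.
  by rewrite tensor_app_scale Ap !mxE exprMn mulrCA.
have le_i := tensor_app_le i ycp.
split.
  rewrite -(ler_pM2r (exprn_gt0 k.-1 (cp0 i))) -Acp -yi.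
  exact: le_trans (nuy i) le_i.
move=> nurho; exists c => //; apply/rowP.
move=> j; apply: (connect_invariant (P := fun j => y 0 j = (c *: p) 0 j)
  (A_irr i j)) => // {}j l arc yl.
apply: tensor_app_eq arc => //; apply/eqP; rewrite eq_le tensor_app_le //=.
by rewrite Acp -yl -nurho.
Qed.
End Perron.

(** * Existence of a positive eigenvector *)

Lemma shrink (R : realFieldType) (d : nat) (a r y : R) :
  0 <= a -> 0 < y -> a < r * y ^+ d -> exists2 z, 0 < z < y & a < r * z ^+ d.
Proof.
move=> a0 y0 ary.
have yd0 : 0 < y ^+ d by rewrite exprn_gt0.
have r0 : 0 < r by rewrite -(pmulr_lgt0 _ yd0) (le_lt_trans a0).
have ry0 : 0 < r * y ^+ d by rewrite mulr_gt0.
set q := a / (r * y ^+ d).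
have q0 : 0 <= q by rewrite divr_ge0 // ltW.
have q1 : q < 1 by rewrite ltr_pdivrMr ?mul1r.
(* Bernoulli's inequality replaces a continuity argument: [z = y * (1 - e)] works as soon as
   [d * e < 1 - q]. The denominator [d.+2] ensures this and keeps [e < 1] even when [d = 0] and
   [q = 0]. *)
set e := (1 - q) / d.+2%:R.
have d2 : (0 : R) < d.+2%:R by rewrite ltr0n.
have e0 : 0 < e by rewrite divr_gt0 ?subr_gt0.
have ed : e * d.+2%:R = 1 - q by rewrite divfK ?lt0r_neq0.
have e1 : e < 1.
  rewrite ltr_pdivrMr // mul1r.
  have : (2 : R) <= d.+2%:R by rewrite ler_nat.
  lra.
clearbody e.
have bern m : 1 - m%:R * e <= (1 - e) ^+ m.
  elim: m => [|m IHm]; first by rewrite mul0r subr0.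
  rewrite exprS; apply: le_trans (ler_wpM2l _ IHm); last lra.
  have : (0 : R) <= m%:R * e * e by rewrite !mulr_ge0 ?ler0n ?(ltW e0).
  by rewrite -[m.+1]addn1 natrD; nra.
exists (y * (1 - e)).
  by apply/andP; split; nra.
rewrite exprMn mulrA; have -> : a = r * y ^+ d * q by rewrite mulrC divfK ?lt0r_neq0.
rewrite ltr_pM2l //; apply: lt_le_trans (bern d).
have : (d%:R : R) * e < 1 - q.
  by rewrite -ed mulrC ltr_pM2l // ltr_nat ltnS leqW.
lra.
Qed.

Section PerronExistence.
(* These imports stay local: their notations are incompatible with mpoly. *)
Import topology normedtype derive realfun numFieldNormedType.Exports.

Variables (R : realType) (k n : nat) (A : tensor R k n).
Hypothesis A_ge0 : forall i t, 0 <= A i t.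
Hypothesis A_irr : weakly_irreducible A.
Implicit Types (x y z p : 'rV[R]_n).

(* Shrinking a coordinate [j] with strict inequality makes the inequality
   strict at every [i] with an arc to [j]. *)
Lemma eigenvector_of_minimal_ratio (r : R) y :
    (forall z, (forall i, 0 < z 0 i) ->
       exists i, r * z 0 i ^+ k.-1 <= tensor_app A z 0 i) ->
    (forall i, 0 < y 0 i) ->
    (forall i, tensor_app A y 0 i <= r * y 0 i ^+ k.-1) ->
  exists2 p : 'rV[R]_n, (forall i, 0 < p 0 i) & eigen_eq A r p.
Proof.
move=> rmin.
pose S z := [set i : 'I_n | tensor_app A z 0 i == r * z 0 i ^+ k.-1]%SET.
have [m] := ubnP #|S y|; elim: m y => // m IHm y; rewrite ltnS => ym y0 Ay.
have [/forallP allS|] := boolP [forall i, i \in S y].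
  exists y => //; apply/rowP => i; have := allS i.
  by rewrite inE !mxE => /eqP.
rewrite negb_forall => /existsP[j0 j0S].
have [i0 i0S] : exists i, i \in S y.
  by have [i ri] := rmin y y0; exists i; rewrite inE eq_le Ay.
(* The set [S y] of equality indices is neither empty nor everything, so by strong connectedness
   some arc leaves it. *)
have [i [j [arc iS jS]]] : exists i j,
    [/\ tensor_arc A i j, i \in S y & j \notin S y].
  apply: contrapT => noarc; move/negP: j0S; apply.
  apply: (connect_invariant (P := fun j => j \in S y) (A_irr i0 j0) i0S).
  move=> i j arc iS.
  by apply: contrapT => /negP jS; apply: noarc; exists i, j.
have Ay_ge0 l : 0 <= tensor_app A y 0 l.
  rewrite mxE sumr_ge0 // => t _; rewrite mulr_ge0 // prodr_ge0 // => u _.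
  exact: ltW.
have [z /andP[z0 zy] Az] : exists2 z, 0 < z < y 0 j &
    tensor_app A y 0 j < r * z ^+ k.-1.
  by apply: shrink => //; rewrite lt_def eq_sym Ay andbT; rewrite inE in jS.
pose y' : 'rV[R]_n := \row_l (if l == j then z else y 0 l).
have y'0 l : 0 < y' 0 l by rewrite mxE; case: eqP.
have y'y l : 0 <= y' 0 l <= y 0 l.
  by rewrite ltW //= mxE; case: eqP => [->|//]; exact: ltW.
have leA l := tensor_app_le A_ge0 l y'y.
have y'l l : l != j -> y' 0 l = y 0 l by rewrite mxE => /negPf->.
have y'j : y' 0 j = z by rewrite mxE eqxx.
apply: (IHm y') => //.
  (* No index enters the equality set: the value at [j] stays strict, and the other coordinates are
     unchanged while the left-hand sides can only decrease. The index [i] leaves it because its arc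
     ends at the shrunken coordinate [j]. *)
  apply: leq_trans ym; apply: proper_card; apply/properP; split.
    apply/fintype.subsetP => l; rewrite !inE; have [->|lj] := eqVneq l j.
      rewrite y'j => /eqP e; have := leA j.
      by rewrite leNgt e Az.
    by rewrite y'l // => /eqP e; rewrite eq_le Ay -e leA.
  exists i => //; rewrite inE; apply/negP => /eqP e.
  have ij : i != j by apply: contraNneq jS => <-.
  have : y' 0 j = y 0 j.
    apply: (tensor_app_eq A_ge0 y'y y0 _ arc).
    by move: iS; rewrite e y'l // inE => /eqP.
  by move=> y'yj; rewrite -y'yj y'j ltxx in zy.
move=> l; have [->|lj] := eqVneq l j.
  by rewrite y'j; apply: le_trans (leA j) (ltW Az).
by rewrite y'l //; apply: le_trans (leA l) (Ay l).
Qed.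

Lemma ge1_le_prod (s : seq 'I_n) (f : 'I_n -> R) j :
  (forall i, 1 <= f i) -> j \in s -> f j <= \prod_(i <- s) f i.
Proof.
move=> f1; have f0 i : 0 <= f i by exact: le_trans (f1 i).
elim: s => // a s IHs; rewrite inE big_cons => /orP[/eqP ->|/IHs fs].
  rewrite ler_peMr //; elim: s {IHs} => [|b s IHs]; first by rewrite big_nil.
  by rewrite big_cons mulr_ege1.
by rewrite (le_trans fs) // ler_peMl // prodr_ge0.
Qed.

(* Normalising the least coordinate to [1] (rather than the largest) is what
   makes weak irreducibility sufficient: the other factors of a monomial are
   then at least [1]. *)
Lemma coercive (C : R) : 0 <= C -> exists K, forall y,
    (forall i, 1 <= y 0 i) -> (exists i, y 0 i = 1) ->
    (forall i, tensor_app A y 0 i <= C * y 0 i ^+ k.-1) ->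
  forall j, y 0 j <= K.
Proof.
move=> C0.
pose ok y := (forall i, 1 <= y 0 i) /\
  (forall i, tensor_app A y 0 i <= C * y 0 i ^+ k.-1).
have bnd i j : exists b, forall y, ok y -> y 0 i = 1 -> y 0 j <= b.
  apply: (connect_invariant (P := fun j => exists b, forall y, ok y ->
    y 0 i = 1 -> y 0 j <= b) (A_irr i j)).
    by exists 1 => y _ ->.
  move=> {}j l /existsP[t /andP[At lt]] [b yb].
  have At0 : 0 < A j t by rewrite lt_def At A_ge0.
  (* The single term of [t] already gives [A j t * y_l <= (A y^{k-1})_j <= C * b^{k-1}]. *)
  exists (C * b ^+ k.-1 / A j t) => y oky yi; rewrite ler_pdivlMr //.
  have [y1 Ay] := oky; have y0 u : 0 <= y 0 u by exact: le_trans (y1 u).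
  apply: le_trans (_ : C * y 0 j ^+ k.-1 <= _); last first.
    by rewrite ler_wpM2l // lerXn2r ?nnegrE ?(le_trans _ (yb y oky yi)) ?yb.
  apply: le_trans (Ay j); rewrite mulrC mxE (bigD1 t) //=.
  rewrite -[leLHS]addr0 lerD //.
    by rewrite ler_wpM2l //; apply: ge1_le_prod lt.
  by apply: sumr_ge0 => u _; rewrite mulr_ge0 // prodr_ge0.
have [b yb] : exists b : 'I_n -> 'I_n -> R,
    forall i j y, ok y -> y 0 i = 1 -> y 0 j <= b i j.
  apply: (fin_all_exists (P := fun i (bi : 'I_n -> R) =>
    forall j y, ok y -> y 0 i = 1 -> y 0 j <= bi j)) => i.
  exact: fin_all_exists (bnd i).
exists (\sum_i \sum_j `|b i j|) => y y1 [i yi] Ay j.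
rewrite (le_trans (yb i j y (conj y1 Ay) yi)) //.
rewrite (le_trans (ler_norm _)) // (bigD1 i) //= (bigD1 j) //= -addrA.
by rewrite lerDl addr_ge0 // sumr_ge0 // => *; rewrite sumr_ge0.
Qed.

Lemma ratio_continuous y : (forall i, 1 <= y 0 i) ->
  {for y, continuous (fun z => \big[Num.max/0]_i
     (tensor_app A z 0 i / z 0 i ^+ k.-1))}.
Proof.
move=> y1; apply: (cvg_big max_continuous (F := nbhs y)) => i _.
have cont_app : tensor_app A z 0 i @[z --> y] --> tensor_app A y 0 i.
  rewrite mxE; under eq_cvg do rewrite mxE.
  apply: (cvg_big add_continuous (F := nbhs y)) => t _.
  apply: cvgM; first exact: cvg_cst.
  by apply: (cvg_big mul_continuous (F := nbhs y)) => j _; exact: coord_continuous.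
apply: cvgM => //; apply: cvgV.
  by rewrite expf_neq0 // lt0r_neq0 // (lt_le_trans ltr01).
apply: (@cvg_comp _ _ _ (fun z : 'rV[R]_n => z 0 i) (fun u => u ^+ k.-1)
  (nbhs y) _ _ (@coord_continuous R 1 n 0 i y)).
exact: exprn_continuous.
Qed.

(** Collatz-Wielandt argument: [f], the largest ratio, is minimised over the compact cube
    [[1, K]^n]. With [K] coming from [coercive] at the level [f one], every positive vector whose
    ratios do not exceed [f one] lies in the cube once its least coordinate is scaled to 1. The
    minimum is therefore global on positive vectors, as [eigenvector_of_minimal_ratio] requires. *)
Lemma perron_exists : (0 < n)%N ->
  exists rho (p : 'rV[R]_n), (forall i, 0 < p 0 i) /\ eigen_eq A rho p.
Proof.
move=> n0.
pose f z := \big[Num.max/0]_i (tensor_app A z 0 i / z 0 i ^+ k.-1).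
have fle r z : 0 <= r -> (forall i, 0 < z 0 i) -> (f z <= r) <->
    (forall i, tensor_app A z 0 i <= r * z 0 i ^+ k.-1).
  move=> r0 z0; split => [fr i|Az].
    rewrite -ler_pdivrMr ?exprn_gt0 //; apply: le_trans fr.
    exact: (le_bigmax _ (fun i => tensor_app A z 0 i / z 0 i ^+ k.-1)).
  by apply: bigmax_le => // i _; rewrite ler_pdivrMr ?exprn_gt0.
have f0 z : 0 <= f z by exact: bigmax_ge_id.
pose one : 'rV[R]_n := const_mx 1.
have [K0 Kbound] := coercive (f0 one).
(* The maximum with 1 guarantees that the cube contains [one]. *)
pose K := Num.max 1 K0.
pose Q := [set z : 'rV[R]_n | forall i, [set` `[1, K]] (z 0 i)].
have one_Q : Q one by move=> i /=; rewrite mxE in_itv /= lexx le_max lexx.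
have Q1 z : Q z -> forall i, 1 <= z 0 i.
  by move=> Qz i; have := Qz i; rewrite /= in_itv /= => /andP[].
have gt0_ge1 z : (forall i, 1 <= z 0 i) -> forall i, 0 < z 0 i.
  by move=> z1 i; apply: lt_le_trans (z1 i).
have [y] : exists2 y, y \in Q & forall z, z \in Q -> f y <= f z.
  apply: EVT_min_rV; first by exists one.
    by apply: (@rV_compact R n (fun=> [set` `[1, K]])) => _; exact: segment_compact.
  apply: continuous_in_subspaceT => z; rewrite inE => Qz.
  exact: ratio_continuous (Q1 z Qz).
rewrite inE => Qy ymin; exists (f y).
have [] := @eigenvector_of_minimal_ratio (f y) y; last 1 first.
- by move=> p p0 Ap; exists p.
- move=> z z0; apply: contrapT => Nz.
  have {}Nz i : tensor_app A z 0 i < f y * z 0 i ^+ k.-1.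
    by rewrite ltNge; apply/negP => ?; apply: Nz; exists i.
  have [i _ imin] := @arg_minP _ R _ (Ordinal n0) xpredT (fun i => z 0 i) erefl.
  have {}imin j : z 0 i <= z 0 j by exact: imin.
  pose z' := (z 0 i)^-1 *: z.
  have z'E j : z' 0 j = z 0 j / z 0 i by rewrite mxE mulrC.
  have z'1 j : 1 <= z' 0 j by rewrite z'E ler_pdivlMr // mul1r.
  have z'0 := gt0_ge1 _ z'1.
  have Nz' j : tensor_app A z' 0 j < f y * z' 0 j ^+ k.-1.
    rewrite tensor_app_scale z'E [z 0 j / _]mulrC exprMn mulrCA mxE.
    by rewrite ltr_pM2l // exprn_gt0 // invr_gt0.
  have Qz' : Q z'.
    move=> j /=; rewrite in_itv /= z'1 /= le_max; apply/orP; right.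
    apply: Kbound => //; first by exists i; rewrite z'E divff ?lt0r_neq0.
    apply/fle => //; apply: le_trans (ymin one _); last by rewrite inE.
    by apply/fle => // l; exact: ltW.
  (* The maximum defining [f] starts from 0, so the strict bound [f z' < f y] also needs [f y] to be
     positive. *)
  have fy0 : 0 < f y.
    rewrite -(pmulr_lgt0 _ (exprn_gt0 k.-1 (z'0 i))).
    apply: le_lt_trans (Nz' i); rewrite mxE sumr_ge0 // => t _.
    by rewrite mulr_ge0 // prodr_ge0 // => u _; exact: ltW.
  have : f z' < f y.
    by apply: bigmax_lt => // j _; rewrite ltr_pdivrMr // exprn_gt0.
  by rewrite ltNge ymin // inE.
- exact: gt0_ge1 (Q1 y Qy).
- by apply/fle => //; exact: gt0_ge1 (Q1 y Qy).
Qed.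
End PerronExistence.

(** * Inverting the Laplacian of a strongly connected weighted digraph *)

Lemma sum_delta (K : pzSemiRingType) (I : finType) (i : I) (f : I -> K) :
  \sum_j (i == j)%:R * f j = f i.
Proof.
rewrite (bigD1 i) //= eqxx mul1r big1 ?addr0 // => j ji.
by rewrite eq_sym (negPf ji) mul0r.
Qed.

(* [K u = L u + u_j0] is injective: by the maximum principle at the extremal
   entries of [u], [K u = 0] forces [u_j0 = 0] and then [u] constant. *)
Lemma laplacian_inverse (R : realFieldType) (n : nat) (W : 'I_n -> 'I_n -> R)
    (j0 : 'I_n) :
    (forall i j, 0 <= W i j) ->
    (forall i j, connect (fun i j => W i j != 0) i j) ->
  exists (U : 'I_n -> 'I_n -> R) (alpha : 'I_n -> R),
    [/\ forall l, U j0 l = 0, \sum_l alpha l = 1 &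
        forall i l, \sum_j W i j * (U i l - U j l) = (i == l)%:R - alpha l].
Proof.
move=> W0 Wirr.
pose K := \matrix_(i, j) ((i == j)%:R * \sum_l W i l - W i j + (j == j0)%:R).
have KE (u : 'I_n -> R) i :
    \sum_j K i j * u j = \sum_j W i j * (u i - u j) + u j0.
  rewrite (eq_bigr (fun j => (i == j)%:R * ((\sum_l W i l) * u j)
    - W i j * u j + (j0 == j)%:R * u j)); last first.
    by move=> j _; rewrite mxE mulrDl mulrBl -mulrA [j0 == j]eq_sym.
  rewrite big_split sumrB /= !sum_delta; congr (_ + _).
  by rewrite mulr_suml -sumrB; apply: eq_bigr => j _; rewrite mulrBr.
have Kinj (u : 'I_n -> R) : (forall i, \sum_j K i j * u j = 0) ->
    forall i, u i = 0.
  move=> Ku.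
  have [imin _ umin] := @arg_minP _ R _ j0 xpredT u erefl.
  have [imax _ umax] := @arg_maxP _ R _ j0 xpredT u erefl.
  have {}umin j : u imin <= u j by exact: umin.
  have {}umax j : u j <= u imax by exact: umax.
  have u0 : u j0 = 0.
    apply/eqP; rewrite eq_le; apply/andP; split.
      have := Ku imax; rewrite KE => /eqP; rewrite addr_eq0 => /eqP e.
      rewrite -oppr_ge0 -e sumr_ge0 // => j _.
      by rewrite mulr_ge0 // subr_ge0.
    have := Ku imin; rewrite KE => /eqP; rewrite addr_eq0 => /eqP e.
    rewrite -oppr_le0 -e -oppr_ge0 -sumrN sumr_ge0 // => j _.
    by rewrite -mulrN opprB mulr_ge0 // subr_ge0.
  have uconst j : u j = u imax.
    apply: (connect_invariant (P := fun j => u j = u imax) (Wirr imax j)) => //.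
    move=> a b Wab ua; have := Ku a; rewrite KE u0 addr0 => /psumr_eq0P e.
    have /eqP : W a b * (u a - u b) = 0.
      by apply: e => // l _; rewrite mulr_ge0 // subr_ge0 ua.
    by rewrite mulf_eq0 (negPf Wab) /= subr_eq0 ua => /eqP.
  by move=> i; rewrite uconst -(uconst j0).
have Ku : K \in unitmx.
  rewrite -unitmx_tr -row_free_unit; apply: inj_row_free => v vK.
  apply/rowP => i; rewrite mxE; apply: (Kinj (fun i => v 0 i)) => {}i.
  move/rowP/(_ i): vK; rewrite mxE [RHS]mxE => e.
  rewrite -[RHS]e; apply: eq_bigr => j _.
  by rewrite !mxE mulrC.
pose V := invmx K.
have VK i l : \sum_j W i j * (V i l - V j l) + V j0 l = (i == l)%:R.
  have /matrixP/(_ i l) := mulmxV Ku; rewrite mxE [RHS]mxE => <-.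
  by rewrite -(KE (fun i => V i l)).
(* With [V] the inverse of [K], [alpha] is the row [j0] of [V]. Subtracting that row from all rows
   makes the row [j0] of [U] vanish without changing the differences that the Laplacian sees. *)
exists (fun i l => V i l - V j0 l), (fun l => V j0 l); split.
- by move=> l; rewrite subrr.
- have /matrixP e := mulVmx Ku.
  (* The Laplacian kills constants, so [K], and hence its inverse, fixes the all-ones vector; this
     is why [alpha] sums to 1. *)
  have K1 i : \sum_j K i j = 1.
    have := KE (fun=> 1) i; rewrite subrr; under eq_bigr do rewrite mulr1.
    by move=> ->; rewrite big1 ?add0r // => j _; rewrite mulr0.
  have : \sum_j (invmx K *m K) j0 j = 1.
    rewrite -(sum_delta j0 (fun=> 1)); apply: eq_bigr => j _.
    by rewrite e mxE mulr1.
  under eq_bigr do rewrite mxE.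
  by rewrite exchange_big /=; under eq_bigr do rewrite -mulr_sumr K1 mulr1.
- move=> i l; rewrite -(VK i l) addrK; apply: eq_bigr => j _.
  by rewrite opprB addrA subrK.
Qed.

(** * Complex eigenvectors compared with the Perron vector *)

Section ComplexEigenvectors.
Variables (R : realType) (k n : nat) (A : tensor R k n).
Hypothesis A_ge0 : forall i t, 0 <= A i t.
Hypothesis A_irr : weakly_irreducible A.
Variables (rho : R) (p : 'rV[R]_n).
Hypothesis p_gt0 : forall i, 0 < p 0 i.
Hypothesis Ap : eigen_eq A rho p.
Local Notation toC := (real_complex R).
Implicit Types (x : 'rV[R[i]]_n) (mu : R[i]).

Lemma normC_real_row x : exists2 y : 'rV[R]_n,
  forall i, `|x 0 i| = toC (y 0 i) & forall i, 0 <= y 0 i.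
Proof.
have e i : `|x 0 i| = toC ((\row_i complex.Re `|x 0 i|) 0 i).
  by rewrite mxE RRe_real // normr_real.
by exists (\row_i complex.Re `|x 0 i|) => // i; rewrite -ler0c -e.
Qed.

Lemma normC_term x (y : 'rV[R]_n) i (t : k.-1.-tuple 'I_n) :
  (forall i, `|x 0 i| = toC (y 0 i)) ->
  `|complex_tensor A i t * \prod_(j <- t) x 0 j| =
  toC (A i t * \prod_(j <- t) y 0 j).
Proof.
move=> xy; rewrite normrM normr_prod rmorphM rmorph_prod /=.
rewrite ger0_norm ?ler0c //; congr (_ * _).
by apply: eq_bigr.
Qed.

(** By the triangle inequality, [y = |x|] satisfies the real subeigenvector inequality with [|mu|],
    so [perron_comparison] applies. *)
Lemma complex_eigen_comparison mu x (y : 'rV[R]_n) :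
    eigen_eq (complex_tensor A) mu x -> x != 0 ->
    (forall i, `|x 0 i| = toC (y 0 i)) -> (forall i, 0 <= y 0 i) ->
  `|mu| <= toC rho /\ (mu = toC rho -> exists2 c, 0 < c & y = c *: p).
Proof.
move=> Ax x0 xy y0.
have muE : `|mu| = toC (complex.Re `|mu|) by rewrite RRe_real // normr_real.
have yn0 : y != 0.
  apply: contra x0 => /eqP y00; apply/eqP/rowP => i; apply/eqP.
  by rewrite mxE -normr_eq0 xy y00 mxE.
have sub i : complex.Re `|mu| * y 0 i ^+ k.-1 <= tensor_app A y 0 i.
  rewrite -lecR rmorphM rmorphXn /= -muE -xy -normrX -normrM.
  have /rowP/(_ i) := Ax; rewrite mxE [RHS]mxE [X in mu * X]mxE => <-.
  apply: le_trans (ler_norm_sum _ _ _) _; rewrite mxE rmorph_sum /=.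
  by apply: ler_sum => t _; rewrite (normC_term _ _ xy).
have [le_rho eq_rho] := perron_comparison A_ge0 A_irr p_gt0 Ap y0 yn0 sub.
split; first by rewrite muE lecR.
(* What is needed is [|mu| = rho], which follows from [mu = rho] because [rho >= |mu| >= 0]. *)
move=> mu_rho; apply: eq_rho.
rewrite mu_rho ger0_norm // ler0c; apply: le_trans le_rho.
by rewrite -ler0c -muE.
Qed.

(** The terms of the eigenvalue equation of [p] in row [i], normalised so that they sum to [rho].
    They do not change when [p] is rescaled. *)
Definition perron_weight i t := A i t * (\prod_(j <- t) p 0 j) / p 0 i ^+ k.-1.

Lemma perron_weight_ge0 i t : 0 <= perron_weight i t.
Proof.
have p0 j : 0 <= p 0 j by exact: ltW.
by rewrite divr_ge0 ?exprn_ge0 // mulr_ge0 // prodr_ge0.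
Qed.

Lemma perron_weight_gt0 i t : A i t != 0 -> 0 < perron_weight i t.
Proof.
move=> At; have At0 : 0 < A i t by rewrite lt_def At A_ge0.
by rewrite divr_gt0 ?exprn_gt0 // mulr_gt0 // prodr_gt0.
Qed.

Lemma sum_perron_weight i : \sum_t perron_weight i t = rho.
Proof.
have /rowP/(_ i) := Ap; rewrite !mxE => e.
by rewrite -mulr_suml e mulfK // expf_neq0 // lt0r_neq0.
Qed.

(* Equality holds in the triangle inequality, so all the terms of
   [(A x^{k-1})_i] are aligned with [x_i^{k-1}]. *)
Lemma complex_eigenvector_aligned x : eigen_eq (complex_tensor A) (toC rho) x ->
    x != 0 ->
  (forall i, x 0 i != 0) /\
  (forall i t, complex_tensor A i t * \prod_(j <- t) x 0 j =
     toC (perron_weight i t) * x 0 i ^+ k.-1).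
Proof.
move=> Ax x0; have [y xy y0] := normC_real_row x.
have [_ /(_ erefl) [c c0 ycp]] := complex_eigen_comparison Ax x0 xy y0.
split=> [i|i t].
  rewrite -normr_eq0 xy ycp mxE.
  by apply/eqP => -[] /eqP; rewrite mulf_eq0 !gt_eqF.
have /rowP/(_ i) := Ax; rewrite !mxE => sumF.
set F := fun t : k.-1.-tuple 'I_n => complex_tensor A i t * \prod_(j <- t) x 0 j.
have normF u : `|F u| = toC (perron_weight i u) * `|x 0 i| ^+ k.-1.
  rewrite /F (normC_term _ _ xy) xy -rmorphXn -rmorphM; congr toC.
  rewrite ycp mxE (eq_bigr (fun j => c * p 0 j)); last by move=> j _; rewrite mxE.
  rewrite prod_tuple_scale exprMn /perron_weight.
  by field; rewrite lt0r_neq0 // exprn_gt0.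
have rho0 : 0 <= rho.
  by rewrite -(sum_perron_weight i) sumr_ge0 // => u _; exact: perron_weight_ge0.
have sum_normF : `|\sum_u F u| = \sum_u `|F u|.
  under [RHS]eq_bigr do rewrite normF.
  rewrite -mulr_suml -rmorph_sum /= sum_perron_weight sumF normrM normrX.
  by rewrite ger0_norm // ler0c.
(* All the terms [F v] are the multiples [|F v| * u] of one unit complex number [u]. *)
have [u _ Fu] := normC_sum_eq sum_normF.
(* If [rho = 0], the weights are nonnegative with sum 0, so both sides vanish. Otherwise summing
   [F v = |F v| * u] and cancelling [rho] gives [|x_i|^{k-1} * u = x_i^{k-1}], which identifies
   [u]. *)
have [rho_eq0|rho_neq0] := eqVneq rho 0.
  have w0 : perron_weight i t = 0.
    have /psumr_eq0P : \sum_t perron_weight i t = 0 by rewrite sum_perron_weight.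
    by apply=> // v _; exact: perron_weight_ge0.
  by rewrite -/(F t) Fu // normF w0 !mul0r.
rewrite -/(F t) Fu // normF -mulrA; congr (_ * _).
have rhoC : toC rho != 0 by apply: contraNneq rho_neq0 => -[->].
apply: (mulfI rhoC); rewrite -sumF -/F (eq_bigr (fun t => `|F t| * u)) => [|v _].
  rewrite -mulr_suml; under eq_bigr do rewrite normF.
  by rewrite -mulr_suml -rmorph_sum /= sum_perron_weight mulrA.
exact: Fu.
Qed.
End ComplexEigenvectors.

Import mpoly.

(** * Multiplicity of the resultant *)

Lemma poly_horner0 (K : numFieldType) (p : {poly K}) :
  (forall s, p.[s] = 0) -> p = 0.
Proof.
move=> p0; apply: (@roots_geq_poly_eq0 _ p [seq i%:R | i <- iota 0 (size p)]).
- by apply/allP => s _; exact/eqP/p0.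
- by rewrite map_inj_uniq ?iota_uniq // => i j /eqP; rewrite eqr_nat => /eqP.
- by rewrite size_map size_iota.
Qed.

Lemma horner_mmap (K : comNzRingType) (N : nat) (g : 'I_N -> {poly K})
    (p : {mpoly K[N]}) (s : K) :
  (mmap polyC g p).[s] = p.@[fun j => (g j).[s]].
Proof.
rewrite /meval /mmap horner_sum; apply: eq_bigr => m _.
rewrite hornerM hornerC /mmap1 horner_prod; congr (_ * _).
by apply: eq_bigr => j _; rewrite horner_exp.
Qed.

Lemma poly_split0 (K : comNzRingType) (p : {poly K}) :
  exists q : {poly K}, forall s, p.[s] = p.[0] + s * q.[s].
Proof.
elim/poly_ind: p => [|p c _]; first by exists 0 => s; rewrite !hornerC mulr0 addr0.
by exists p => s; rewrite !hornerE addrC [s * _]mulrC.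
Qed.

Lemma meval_line (K : comNzRingType) (N : nat) (p : {mpoly K[N]})
    (h v : 'I_N -> K) :
  exists q : {poly K}, forall s, q.[s] = p.@[fun j => h j + s * v j].
Proof.
exists (mmap polyC (fun j => (h j)%:P + 'X * (v j)%:P) p) => s.
by rewrite horner_mmap; apply: meval_eq => j; rewrite !hornerE.
Qed.

(** Density of the complement of finitely many hyperplanes, removed one at a time. Through a point
    [h] off the hyperplanes of [s] there is a line not contained in the hyperplane of [a]; it meets
    all of them in finitely many points, so [T] vanishes on the whole line. *)
Lemma meval0_off_hyperplanes (K : numFieldType) (N : nat) (I : eqType)
    (phi : I -> ('I_N -> K) -> K) (s : seq I) (T : {mpoly K[N]}) :
    (forall i h v b, phi i (fun j => h j + b * v j) = phi i h + b * phi i v) ->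
    (forall i, i \in s -> exists h, phi i h != 0) ->
    (forall h, (forall i, i \in s -> phi i h != 0) -> T.@[h] = 0) ->
  forall h, T.@[h] = 0.
Proof.
move=> philin; elim: s => [_ T0 h|a s IHs nz T0]; first exact: T0.
apply: IHs => [i si|h hs]; first by apply: nz; rewrite inE si orbT.
have [v phiv] := nz a (mem_head a s).
have [q qE] := meval_line T h v.
pose L i : {poly K} := (phi i h)%:P + 'X * (phi i v)%:P.
have LE i b : (L i).[b] = phi i (fun j => h j + b * v j).
  by rewrite philin !hornerE.
have L0 i : phi i h != 0 -> L i != 0.
  by apply: contraNneq => Li; rewrite -[phi i h]addr0 -[X in _ + X](mul0r (phi i v))
    -philin -LE Li horner0.
have La : L a != 0.
  apply: contraNneq phiv => /polyP/(_ 1%N).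
  by rewrite coefD coefC coefXM coefC add0r coef0 => ->.
(* At each parameter either some linear factor vanishes or the point is off all the hyperplanes and
   [q] vanishes. The linear factors are nonzero polynomials, hence [q = 0]. *)
have : q * (L a * \prod_(i <- s) L i) = 0.
  apply: poly_horner0 => b; rewrite !hornerM horner_prod.
  have [e|Nab] := eqVneq (phi a (fun j => h j + b * v j)) 0.
    by rewrite LE e mul0r mulr0.
  have [/allP alls|/allPn[i si]] := boolP (all (fun i => (L i).[b] != 0) s).
    rewrite qE T0 ?mul0r // => i; rewrite inE => /orP[/eqP-> //|si].
    by rewrite -LE alls.
  rewrite negbK => /eqP Lib.
  rewrite [X in _ * (_ * X)](_ : _ = 0) ?mulr0 //; apply/eqP.
  by rewrite prodf_seq_eq0; apply/hasP; exists i; rewrite //= Lib.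
move=> /eqP; rewrite !mulf_eq0 (negPf La) /= prodf_seq_eq0.
rewrite [has _ _](_ : _ = false) ?orbF => [/eqP q0|]; last first.
  by apply/hasPn => i si /=; rewrite L0 // hs.
have := qE 0; rewrite q0 horner0 => ->; apply: meval_eq => j.
by rewrite mul0r addr0.
Qed.

(** * Lowest homogeneous part along arcs and lines *)

Section HomogeneousParts.
Variables (K : numFieldType) (N : nat) (P : {mpoly K[N]}).
Local Notation part i := (pihomog [measure of mdeg] i P).

Lemma meval_part i h : (part i).@[h] =
  \sum_(m <- msupp P | mdeg m == i) P@_m * \prod_j h j ^+ m j.
Proof.
rewrite pihomogE rmorph_sum /=; apply: eq_bigr => m _.
by rewrite mevalZ mevalX.
Qed.

Lemma prod_scale_mnm (L : comNzRingType) (s : L) (h : 'I_N -> L) (m : 'X_{1..N}) :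
  \prod_j (s * h j) ^+ m j = s ^+ mdeg m * \prod_j h j ^+ m j.
Proof.
under eq_bigr do rewrite exprMn.
by rewrite big_split /= mdegE -expr_sum.
Qed.

(** Only the monomials of degree at least [mu] contribute, and each is divisible by [s ^+ mu]. The
    same factorisation serves for the arcs on the resultant hypersurface and for the final
    pencil. *)
Lemma meval_scale_low mu : (forall i h, (i < mu)%N -> (part i).@[h] = 0) ->
  forall s h, P.@[fun j => s * h j] =
    s ^+ mu * \sum_(m <- msupp P | (mu <= mdeg m)%N)
                 P@_m * s ^+ (mdeg m - mu) * \prod_j h j ^+ m j.
Proof.
move=> low s h.
have low_sum : \sum_(m <- msupp P | (mdeg m < mu)%N)
    P@_m * \prod_j (s * h j) ^+ m j = 0.
  rewrite (eq_bigl (fun m => [exists i : 'I_mu, mdeg m == i])); last first.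
    move=> m; apply/idP/existsP => [lt_m|[i /eqP->//]].
    by exists (Ordinal lt_m).
  transitivity (\sum_(i < mu) (part i).@[fun j => s * h j]); last first.
    by rewrite big1 // => i _; rewrite low.
  under [RHS]eq_bigr do rewrite meval_part big_mkcond.
  rewrite exchange_big big_mkcond; apply: eq_bigr => m _ /=.
  case: existsP => [[i /eqP mi]|nex].
    rewrite (bigD1 i) //= mi eqxx [X in _ + X]big1 ?addr0 // => j ji.
    by rewrite val_eqE eq_sym (negPf ji).
  by rewrite big1 // => j _; case: eqP => // e; case: nex; exists j; exact/eqP.
rewrite mevalE (bigID (fun m : 'X_{1..N} => (mdeg m < mu)%N)) /= low_sum add0r.
rewrite mulr_sumr; apply: eq_big => m; rewrite -leqNgt // => le_m.
rewrite prod_scale_mnm -{1}(subnK le_m) exprD; ring.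
Qed.

(* [P] along the arc [s |-> s Y(s)] starts with its part of degree [mu] at
   [Y(0)]. *)
Lemma lowest_part_arc mu (Y : 'I_N -> {poly K}) :
    (forall i h, (i < mu)%N -> (part i).@[h] = 0) ->
    (forall s, P.@[fun j => s * (Y j).[s]] = 0) ->
  (part mu).@[fun j => (Y j).[0]] = 0.
Proof.
move=> low PY.
pose Q := \sum_(m <- msupp P | (mu <= mdeg m)%N)
   (P@_m)%:P * 'X^(mdeg m - mu) * \prod_j Y j ^+ m j.
have QE s : Q.[s] = \sum_(m <- msupp P | (mu <= mdeg m)%N)
    P@_m * s ^+ (mdeg m - mu) * \prod_j (Y j).[s] ^+ m j.
  rewrite /Q horner_sum; apply: eq_bigr => m _.
  rewrite !hornerM hornerC hornerXn horner_prod; congr (_ * _).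
  by apply: eq_bigr => j _; rewrite horner_exp.
have Q0 : Q = 0.
  have : 'X^mu * Q = 0.
    apply: poly_horner0 => s.
    by rewrite hornerM hornerXn QE -meval_scale_low.
  by move=> /eqP; rewrite mulf_eq0 expf_eq0 polyX_eq0 andbF => /eqP.
have := QE 0; rewrite Q0 horner0 => e; rewrite [RHS]e meval_part.
rewrite [RHS](bigID (fun m : 'X_{1..N} => mdeg m == mu)) /= [X in _ + X]big1 ?addr0.
  apply: eq_big => [m|m /eqP->]; last by rewrite subnn expr0 mulr1.
  by case: eqP => [->|]; rewrite ?leqnn ?andbF.
move=> m /andP[le_m ne_m]; rewrite -[X in 0 ^+ X]prednK; last first.
  by rewrite subn_gt0 ltn_neqAle eq_sym ne_m.
by rewrite exprS mul0r mulr0 mul0r.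
Qed.

(** This degree bound is to be played against the number of tangent hyperplanes that the line
    crosses. *)
Lemma part_line_size mu (g h : 'I_N -> K) : exists2 q : {poly K},
  (size q <= mu.+1)%N & forall a, q.[a] = (part mu).@[fun j => a * g j + h j].
Proof.
pose l j : {poly K} := 'X * (g j)%:P + (h j)%:P.
exists (\sum_(m <- msupp P | mdeg m == mu) (P@_m)%:P * \prod_j l j ^+ m j).
  have sizeM (p q : {poly K}) a b :
      (size p <= a.+1)%N -> (size q <= b.+1)%N -> (size (p * q)%R <= (a + b).+1)%N.
    move=> pa qb; apply: leq_trans (size_polyMleq _ _) _.
    by rewrite -ltnS -addSn; move: (leq_add pa qb); rewrite addnS; lia.
  have size_l j : (size (l j) <= 2)%N.
    apply: leq_trans (size_polyD _ _) _; rewrite geq_max.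
    rewrite (leq_trans (size_polyC_leq1 _)) // andbT.
    have := sizeM 'X (g j)%:P 1%N 0%N.
    by rewrite size_polyX size_polyC_leq1; apply.
  apply: (big_ind (fun p : {poly K} => (size p <= mu.+1)%N)).
    by rewrite size_poly0.
    by move=> p q pm qm; rewrite (leq_trans (size_polyD _ _)) // geq_max pm.
  move=> m /eqP mmu; rewrite -[mu]add0n; apply: (sizeM).
    exact: size_polyC_leq1.
  rewrite -mmu mdegE.
  apply: (big_ind2 (fun (p : {poly K}) e => (size p <= e.+1)%N)).
  - by rewrite size_poly1.
  - by move=> p a q b; exact: sizeM.
  move=> j _; elim: (m j) => [|e IHe]; first by rewrite expr0 size_poly1.
  by rewrite exprS; exact: (@sizeM _ _ 1%N e).
move=> a; rewrite meval_part horner_sum; apply: eq_bigr => m _.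
rewrite hornerM hornerC horner_prod; congr (_ * _).
by apply: eq_bigr => j _; rewrite horner_exp !hornerE [a * _]mulrC.
Qed.
End HomogeneousParts.

(** * Systems of forms and their coefficient vectors *)

Section Systems.
Variables (K : comNzRingType) (n d : nat).
Implicit Types (F H : 'I_n -> {mpoly K[n]}) (c : 'I_(nb_coef n d) -> K).

(** The inverse of [coef_at] on systems of forms of degree [d]; it turns [slope] into a functional
    on the coefficient space where the resultant lives. *)
Definition system_of c : 'I_n -> {mpoly K[n]} := fun r =>
  \sum_(j : 'I_(nb_coef n d) | (enum_val j).1 == r)
    c j *: 'X_[\val (enum_val j).2].

Lemma system_of_homog c r : system_of c r \is d.-homog.
Proof.
apply: rpred_sum => j _; apply: rpredZ.
by rewrite dhomogX; exact: (valP (enum_val j).2).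
Qed.

Lemma coef_system_of c j : coef_at (system_of c) j = c j.
Proof.
rewrite /coef_at raddf_sum /= -(sum_delta j c) big_mkcond /=.
apply: eq_bigr => l _; rewrite mcoeffZ mcoeffX mulrC.
have [<-|jl] := eqVneq j l; first by rewrite !eqxx.
case: eqP => e1; last by rewrite mul0r.
case: eqP => [/val_inj/val_inj e2|]; last by rewrite !mul0r.
case/eqP: jl; apply: enum_val_inj; apply/esym.
by move: e1 e2; case: (enum_val l) (enum_val j) => a b [a' b'] /= -> ->.
Qed.

Lemma coef_at_index (r : 'I_n) (m : 'X_{1..n}) : mdeg m = d ->
  exists j, forall F, coef_at (d := d) F j = (F r)@_m.
Proof.
move=> md; have m_lt : (mdeg m < d.+1)%N by rewrite md.
have mb : mdeg (BMultinom m_lt) == d by rewrite /= md.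
exists (enum_rank (r, exist (fun m : 'X_{1..n < d.+1} => mdeg m == d) _ mb)) => F.
by rewrite /coef_at enum_rankK.
Qed.

Lemma system_of_coef F : (forall r, F r \is d.-homog) ->
  system_of (coef_at F) =1 F.
Proof.
move=> Fd r; apply/mpolyP => m; have [md|md] := eqVneq (mdeg m) d; last first.
  rewrite !(dhomog_nemf_coeff (mf := [measure of mdeg]) (d := d)) //.
  exact: system_of_homog.
by have [j jE] := coef_at_index r md; rewrite -!jE coef_system_of.
Qed.

Lemma coef_at_lin a F H j :
  coef_at (d := d) (fun r => a *: F r + H r) j = a * coef_at F j + coef_at H j.
Proof. by rewrite /coef_at mcoeffD mcoeffZ. Qed.

Lemma system_of_lin b c c' r :
  system_of (fun j => c j + b * c' j) r = system_of c r + b *: system_of c' r.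
Proof.
rewrite /system_of scaler_sumr -big_split; apply: eq_bigr => j _ /=.
by rewrite scalerA scalerDl.
Qed.
End Systems.

(* Each hypothesis [tangent_image] says that the differential of [F0] at the
   zero [x i] has corank one, and identifies a functional [alpha i] that
   vanishes on its image.  Near [F0] the resultant hypersurface then has, for
   each [i], a branch with tangent hyperplane [slope i H = 0], and these
   hyperplanes are distinct. *)
Section Multiplicity.
Variables (C : numClosedFieldType) (n d : nat) (Res : coef_polynomial C n d).
Hypothesis d_gt0 : (0 < d)%N.
Hypothesis Res_zero : forall F : 'I_n -> {mpoly C[n]},
  (forall r, F r \is d.-homog) ->
  (exists2 x : 'rV[C]_n, x != 0 & forall r, (F r).@[fun j => x 0 j] = 0) ->
  Res.@[coef_at F] = 0.
Variables (F0 G : 'I_n -> {mpoly C[n]}).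
Hypotheses (F0_homog : forall r, F0 r \is d.-homog)
           (G_homog : forall r, G r \is d.-homog).
Variables (j0 : 'I_n) (m : nat) (x : 'I_m -> 'rV[C]_n).
Hypotheses (x_j0 : forall i, x i 0 j0 = 1) (x_inj : injective x).
Variable alpha : 'I_m -> 'I_n -> C.

Definition slope i (H : 'I_n -> {mpoly C[n]}) : C :=
  \sum_r alpha i r * (H r).@[fun j => x i 0 j].

Hypothesis slope_G : forall i, slope i G = 1.
Hypothesis tangent_image : forall i (h : 'I_n -> C),
  exists2 w : 'rV[C]_n, w 0 j0 = 0 & forall r, exists E : {poly C}, forall s,
    (F0 r).@[fun j => x i 0 j + s * w 0 j] =
    s * (h r - (\sum_l alpha i l * h l) * (G r).@[fun j => x i 0 j])
      + s ^+ 2 * E.[s].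

Lemma slope_lin i a H H' :
  slope i (fun r => a *: H r + H' r) = a * slope i H + slope i H'.
Proof.
rewrite /slope mulr_sumr -big_split; apply: eq_bigr => r _ /=.
by rewrite mevalD mevalZ; ring.
Qed.

(* Move the zero to [x i + s w], with [w] cancelling the first order term, and
   absorb the remaining error, of order [s^2], in the coefficients of
   ['X_j0 ^+ d], which takes the value 1 at the new zero. *)
Lemma resultant_arc i H : (forall r, H r \is d.-homog) -> slope i H = 0 ->
  exists e : 'I_(nb_coef n d) -> {poly C}, forall s,
    Res.@[fun l => coef_at F0 l + s * (coef_at H l + s * (e l).[s])] = 0.
Proof.
move=> H_homog Hi.
have [w wj0 /fin_all_exists[E EE]] :=
  tangent_image i (fun r => - (H r).@[fun j => x i 0 j]).
have /fin_all_exists[E' EE'] r : exists q : {poly C}, forall s,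
    (H r).@[fun j => x i 0 j + s * w 0 j] = (H r).@[fun j => x i 0 j] + s * q.[s].
  have [p pE] := meval_line (H r) (fun j => x i 0 j) (fun j => w 0 j).
  have [q qE] := poly_split0 p; exists q => s; rewrite -pE qE pE.
  by congr (_ + _); apply: meval_eq => j; rewrite mul0r addr0.
pose X : 'I_n -> {mpoly C[n]} := fun=> 'X_j0 ^+ d.
exists (fun l => - (coef_at X l)%:P * (E (enum_val l).1 + E' (enum_val l).1)) => s.
pose Fs r := F0 r + s *: H r - (s ^+ 2 * (E r + E' r).[s]) *: X r.
have X_homog r : X r \is d.-homog.
  by rewrite /X -[d in d.-homog]mul1n; apply: dhomogMn; rewrite dhomogX /= mdeg1.
rewrite (meval_eq (v2 := coef_at Fs)); last first.
  move=> l; rewrite /coef_at mcoeffB mcoeffD !mcoeffZ !hornerE.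
  by rewrite -/(coef_at X l) /=; ring.
apply: Res_zero => [r|].
  apply: rpredB; [apply: rpredD|]; [exact: F0_homog|exact: dhomogZ|exact: dhomogZ].
exists (x i + s *: w).
  apply/eqP => /rowP/(_ j0)/eqP; rewrite !mxE x_j0 wj0 mulr0 addr0.
  by rewrite oner_eq0.
move=> r; rewrite (meval_eq (v2 := fun j => x i 0 j + s * w 0 j)); last first.
  by move=> j; rewrite !mxE.
rewrite mevalB mevalD !mevalZ rmorphXn /= mevalXU x_j0 wj0 mulr0 addr0 expr1n.
rewrite EE EE' hornerD; under eq_bigr do rewrite mulrN.
by rewrite sumrN -/(slope i H) Hi; ring.
Qed.

(** The zeros differ in some coordinate [q]. Since both are normalised at [j0], the [d]-th power of
    ['X_q - x j 0 q *: 'X_j0] vanishes at [x j] but not at [x i]; it is placed in a row where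
    [alpha i] is nonzero. *)
Lemma slope_separates i j : i != j -> exists2 H : 'I_n -> {mpoly C[n]},
  (forall r, H r \is d.-homog) & slope i H != slope j H.
Proof.
move=> ij.
have [q xq] : exists q, x i 0 q != x j 0 q.
  apply/existsP; rewrite -negb_forall; apply: contra ij => /forallP xe.
  by apply/eqP/x_inj/rowP => q; exact/eqP.
have [r0 alpha0] : exists r, alpha i r != 0.
  apply/existsP; rewrite -negb_forall; apply/negP => /forallP a0.
  have := slope_G i; rewrite /slope big1 => [/esym/eqP|r _].
    by rewrite oner_eq0.
  by rewrite (eqP (a0 r)) mul0r.
pose L : {mpoly C[n]} := 'X_q - x j 0 q *: 'X_j0.
have L1 : L \is 1.-homog.
  by rewrite rpredB ?rpredZ // dhomogX /= mdeg1.
exists (fun r => (r0 == r)%:R *: L ^+ d) => [r|].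
  by apply: dhomogZ; rewrite -[d in d.-homog]mul1n; exact: dhomogMn.
have slopeE l : slope l (fun r => (r0 == r)%:R *: L ^+ d) =
    alpha l r0 * (x l 0 q - x j 0 q) ^+ d.
  rewrite /slope (eq_bigr (fun r => (r0 == r)%:R *
     (alpha l r * (x l 0 q - x j 0 q) ^+ d))) ?sum_delta // => r _.
  rewrite mevalZ rmorphXn /= mevalB mevalZ !mevalXU x_j0 mulr1.
  by rewrite mulrCA.
rewrite !slopeE subrr expr0n eqn0Ngt d_gt0 mulr0 mulf_neq0 // expf_neq0 //.
by rewrite subr_eq0.
Qed.

Let N := nb_coef n d.
(** The resultant recentred at [F0]: its lowest nonzero homogeneous part cuts out the tangent cone
    of the hypersurface there. *)
Let P : {mpoly C[N]} :=
  Res \mPo [tuple 'X_l + (coef_at F0 l)%:MP | l < N].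
Local Notation part i := (pihomog [measure of mdeg] i P).

Lemma translated_eval h : P.@[h] = Res.@[fun l => coef_at F0 l + h l].
Proof.
rewrite comp_mpoly_meval; apply: meval_eq => l.
by rewrite tnth_mktuple mevalD mevalXU mevalC addrC.
Qed.

(** Strong induction on [mu]. Once the lower parts vanish, [resultant_arc] shows that the part of
    degree [mu] vanishes on every tangent hyperplane. If the slopes of [h] are distinct, the line
    through [h] in the direction [G] crosses these hyperplanes at [m > mu] different parameters, too
    many roots for its degree. *)
Lemma low_parts_vanish mu h : (mu < m)%N -> (part mu).@[h] = 0.
Proof.
have [M] := ubnP mu; elim: M mu h => // M IHM mu h; rewrite ltnS => mu_le mu_lt.
have low i h' : (i < mu)%N -> (part i).@[h'] = 0.
  by move=> i_mu; apply: IHM; [exact: leq_trans mu_le|exact: ltn_trans mu_lt].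
have on_branch i (H : 'I_n -> {mpoly C[n]}) : (forall r, H r \is d.-homog) ->
    slope i H = 0 -> (part mu).@[coef_at H] = 0.
  move=> H_homog Hi; have [e eE] := resultant_arc H_homog Hi.
  rewrite -[RHS](lowest_part_arc (Y := fun l => (coef_at H l)%:P + 'X * e l) low).
    by apply: meval_eq => l; rewrite !hornerE.
  move=> s; rewrite translated_eval -[RHS](eE s); apply: meval_eq => l.
  by rewrite !hornerE.
(* The exceptional [h], for which two slopes coincide, lie on finitely many proper hyperplanes and
   are recovered by density. *)
pose pairs := [seq ij <- enum {: 'I_m * 'I_m} | ij.1 != ij.2].
pose phi (ij : 'I_m * 'I_m) (c : 'I_N -> C) :=
  slope ij.1 (system_of c) - slope ij.2 (system_of c).
have slope_system l c c' b : slope l (system_of (fun j => c j + b * c' j)) =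
    slope l (system_of c) + b * slope l (system_of c').
  rewrite addrC -slope_lin; apply: eq_bigr => r _.
  by rewrite system_of_lin addrC.
apply: (meval0_off_hyperplanes (phi := phi) (s := pairs)) => {h}.
- by move=> ij c c' b; rewrite /phi !slope_system; ring.
- move=> [i j]; rewrite mem_filter /= => /andP[ij _].
  have [H H_homog Hij] := slope_separates ij; exists (coef_at H).
  rewrite /phi /= subr_eq0; apply: contra Hij => /eqP e; apply/eqP.
  have sE l : slope l (system_of (coef_at (d := d) H)) = slope l H.
    by apply: eq_bigr => r _; rewrite system_of_coef.
  by rewrite -!sE.
move=> h hne.
have [q q_size qE] := part_line_size P mu (coef_at G) h.
suff q0 : q = 0.
  have := qE 0; rewrite q0 horner0 => e; rewrite [RHS]e.
  by apply: meval_eq => l; rewrite mul0r add0r.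
(* As [slope i G = 1], this is the parameter at which the line meets the tangent hyperplane of index
   [i]. *)
pose a i := - slope i (system_of h).
apply: (@roots_geq_poly_eq0 _ q [seq a i | i <- enum 'I_m]).
- apply/allP => _ /mapP[i _ ->]; rewrite /root qE; apply/eqP.
  rewrite -[RHS](on_branch i (fun r => a i *: G r + system_of h r)).
  + by apply: meval_eq => l; rewrite coef_at_lin coef_system_of.
  + by move=> r; apply: dhomogD; [exact: dhomogZ|exact: system_of_homog].
  + by rewrite slope_lin slope_G mulr1 addNr.
- rewrite map_inj_in_uniq ?enum_uniq // => i j _ _ /oppr_inj e.
  apply/eqP/contraT => ij; have := hne (i, j).
  by rewrite mem_filter ij mem_enum inE /phi /= e subrr eqxx => /(_ isT).
- by rewrite size_map size_enum_ord (leq_trans q_size).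
Qed.

(** On the pencil the increment from [F0] is [('X - z) G], and all monomials of [P] that survive
    have degree at least [m]; [Q] is the explicit quotient. *)
Lemma resultant_pencil_dvd (z : C) : ('X - z%:P) ^+ m %|
  mmap polyC (fun l => (coef_at F0 l)%:P + ('X - z%:P) * (coef_at G l)%:P) Res.
Proof.
pose Q := \sum_(mn <- msupp P | (m <= mdeg mn)%N)
  (P@_mn)%:P * ('X - z%:P) ^+ (mdeg mn - m) * \prod_j (coef_at G j)%:P ^+ mn j.
apply/dvdpP; exists Q; apply/eqP; rewrite -subr_eq0; apply/eqP.
apply: poly_horner0 => s.
rewrite hornerD hornerN hornerM horner_exp horner_mmap.
rewrite (meval_eq (v2 := fun l => coef_at F0 l + (s - z) * coef_at G l)); last first.
  by move=> l; rewrite !hornerE.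
rewrite -(translated_eval (fun l => (s - z) * coef_at G l)).
rewrite (meval_scale_low (mu := m)); last by move=> i h /low_parts_vanish.
rewrite [Q.[s] * _]mulrC !hornerE; apply/eqP; rewrite subr_eq0; apply/eqP.
congr (_ * _); rewrite /Q horner_sum; apply: eq_bigr => mn _.
rewrite !hornerM hornerC horner_exp horner_prod !hornerE; congr (_ * _).
by apply: eq_bigr => j _; rewrite horner_exp hornerC.
Qed.
End Multiplicity.

(** * The least H-eigenvalue *)

Lemma prod_line_expansion (K : comNzRingType) (I : Type) (s : seq I) (u : I -> K) :
  exists E : {poly K}, forall b,
    \prod_(j <- s) (1 + b * u j) = 1 + b * \sum_(j <- s) u j + b ^+ 2 * E.[b].
Proof.
elim: s => [|a s [E EE]].
  by exists 0 => b; rewrite !big_nil hornerC !mulr0 !addr0.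
exists ((u a * \sum_(j <- s) u j)%:P + E + 'X * ((u a)%:P * E)) => b.
by rewrite !big_cons EE !hornerE /=; ring.
Qed.

(** * The differential of the eigenvalue equation at an eigenvector *)

Section PerronTangent.
Variables (R : realType) (k n : nat) (A : tensor R k n).
Hypothesis A_ge0 : forall i t, 0 <= A i t.
Hypothesis A_irr : weakly_irreducible A.
Variables (rho : R) (p : 'rV[R]_n).
Hypothesis p_gt0 : forall i, 0 < p 0 i.
Hypothesis Ap : eigen_eq A rho p.
Local Notation toC := (real_complex R).
Local Notation omega := (perron_weight A p).

(** These are the arc weights of the digraph, with multiplicity for repeated indices; the Laplacian
    itself arises by pairing them with differences [u l - u r]. *)
Definition perron_laplacian (r l : 'I_n) : R :=
  \sum_t omega r t * \sum_(j <- t) (l == j)%:R.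

Lemma perron_laplacian_ge0 r l : 0 <= perron_laplacian r l.
Proof.
apply: sumr_ge0 => t _; rewrite mulr_ge0 ?perron_weight_ge0 //.
by apply: sumr_ge0.
Qed.

Lemma perron_laplacian_irr r l :
  connect (fun i j => perron_laplacian i j != 0) r l.
Proof.
apply: connect_sub (A_irr r l) => i j /existsP[t /andP[At jt]].
apply: connect1; rewrite gt_eqF // /perron_laplacian (bigD1 t) //=.
rewrite ltr_wpDr //.
  apply: sumr_ge0 => u _; rewrite mulr_ge0 ?perron_weight_ge0 //.
  by apply: sumr_ge0.
rewrite mulr_gt0 ?perron_weight_gt0 // (big_rem j) //= eqxx.
by rewrite ltr_wpDr // sumr_ge0.
Qed.

(* With [w_j = x_j u_j], the differential of [A x^{k-1} - rho x^{[k-1]}] at an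
   eigenvector [x] is, up to the factors [x_r^{k-1}], minus the Laplacian of
   the weighted digraph [perron_laplacian], applied to [u]. *)
Lemma eigen_differential (x : 'rV[R[i]]_n) (u : 'I_n -> R[i]) r :
    (forall t, complex_tensor A r t * \prod_(j <- t) x 0 j =
       toC (omega r t) * x 0 r ^+ k.-1) ->
  exists E : {poly R[i]}, forall s,
    tensor_app (complex_tensor A) (\row_j (x 0 j + s * (x 0 j * u j))) 0 r
    - toC rho * (x 0 r + s * (x 0 r * u r)) ^+ k.-1 =
    s * (x 0 r ^+ k.-1 * \sum_l toC (perron_laplacian r l) * (u l - u r))
      + s ^+ 2 * E.[s].
Proof.
move=> aligned.
have /fin_all_exists[E EE] (t : k.-1.-tuple 'I_n) := prod_line_expansion t u.
have /fin_all_exists[E' EE'] (t : k.-1.-tuple 'I_n) :=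
  prod_line_expansion t (fun=> u r).
exists (x 0 r ^+ k.-1 *: \sum_t toC (omega r t) *: (E t - E' t)) => s.
have -> : tensor_app (complex_tensor A) (\row_j (x 0 j + s * (x 0 j * u j))) 0 r
   = x 0 r ^+ k.-1 * \sum_t toC (omega r t) * \prod_(j <- t) (1 + s * u j).
  rewrite mxE mulr_sumr; apply: eq_bigr => t _.
  rewrite (eq_bigr (fun j => x 0 j * (1 + s * u j))); last first.
    by move=> j _; rewrite mxE; ring.
  by rewrite big_split /= [LHS]mulrA aligned; ring.
have -> : toC rho * (x 0 r + s * (x 0 r * u r)) ^+ k.-1
   = x 0 r ^+ k.-1 * \sum_t toC (omega r t) * \prod_(j <- t) (1 + s * u r).
  under eq_bigr do rewrite big_const_seq count_predT size_tuple iter_mulr_1.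
  rewrite -mulr_suml -rmorph_sum (sum_perron_weight p_gt0 Ap) [RHS]mulrCA -exprMn.
  by congr (_ * _ ^+ _); ring.
have -> : \sum_l toC (perron_laplacian r l) * (u l - u r) =
    \sum_t toC (omega r t) * \sum_(j <- t) (u j - u r).
  under eq_bigr do rewrite /perron_laplacian rmorph_sum mulr_suml.
  rewrite exchange_big; apply: eq_bigr => t _ /=.
  under [in RHS]eq_bigr do rewrite -(sum_delta _ (fun l => u l - u r)).
  rewrite exchange_big mulr_sumr; apply: eq_bigr => l _ /=.
  rewrite rmorphM rmorph_sum -mulrA mulr_suml; congr (_ * _).
  by apply: eq_bigr => j _; rewrite rmorph_nat eq_sym.
rewrite hornerZ horner_sum -mulrBr -sumrB !mulr_sumr -big_split.
apply: eq_bigr => t _ /=; rewrite EE EE' hornerZ hornerD hornerN sumrB; ring.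
Qed.

(** The substitutions [w_j = x_j u_j] and [h_r = x_r^{k-1} g_r] reduce the first-order equation to
    the Laplacian one solved by [laplacian_inverse]. The zero row [j0] of [U] keeps the coordinate
    [j0] of the eigenvector fixed. *)
Lemma perron_tangent (x : 'rV[R[i]]_n) j0 :
    (forall i, x 0 i != 0) ->
    (forall i t, complex_tensor A i t * \prod_(j <- t) x 0 j =
       toC (omega i t) * x 0 i ^+ k.-1) ->
  exists2 alpha : 'I_n -> R[i], \sum_r alpha r * x 0 r ^+ k.-1 = 1 &
  forall h : 'I_n -> R[i], exists2 w : 'rV[R[i]]_n, w 0 j0 = 0 &
  forall r, exists E : {poly R[i]}, forall s,
    tensor_app (complex_tensor A) (x + s *: w) 0 r
      - toC rho * (x + s *: w) 0 r ^+ k.-1 =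
    s * (h r - (\sum_l alpha l * h l) * x 0 r ^+ k.-1) + s ^+ 2 * E.[s].
Proof.
move=> x0 aligned.
have xd0 r : x 0 r ^+ k.-1 != 0 by rewrite expf_neq0.
have [U [al [Uj0 al1 LU]]] :=
  laplacian_inverse j0 perron_laplacian_ge0 perron_laplacian_irr.
exists (fun r => toC (al r) / x 0 r ^+ k.-1) => [|h].
  under eq_bigr do rewrite divfK //.
  by rewrite -rmorph_sum al1 rmorph1.
pose g r := h r / x 0 r ^+ k.-1.
(* The sign appears because the differential is minus the Laplacian. *)
pose u r := - \sum_q toC (U r q) * g q.
exists (\row_j (x 0 j * u j)) => [|r].
  by rewrite mxE /u big1 ?oppr0 ?mulr0 // => q _; rewrite Uj0 mul0r.
have [E EE] := eigen_differential u (aligned r); exists E => s.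
have -> : x + s *: \row_j (x 0 j * u j) = \row_j (x 0 j + s * (x 0 j * u j)).
  by apply/rowP => j; rewrite !mxE.
rewrite [X in toC rho * X ^+ _]mxE EE; congr (_ * _ + _).
have -> : \sum_l toC (perron_laplacian r l) * (u l - u r) =
    g r - \sum_q toC (al q) * g q.
  transitivity (\sum_q toC ((r == q)%:R - al q) * g q); last first.
    under eq_bigr do rewrite rmorphB mulrBl rmorph_nat.
    by rewrite sumrB sum_delta.
  under [RHS]eq_bigr do rewrite -LU rmorph_sum mulr_suml.
  rewrite exchange_big; apply: eq_bigr => l _ /=.
  rewrite /u opprK addrC -sumrB mulr_sumr; apply: eq_bigr => q _.
  by rewrite rmorphM rmorphB; ring.
rewrite mulrBr [_ * g r]mulrC divfK // mulrC; congr (_ - _ * _).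
by apply: eq_bigr => q _; rewrite /g; ring.
Qed.
End PerronTangent.

(** * The characteristic polynomial as the resultant of a pencil *)

Lemma prod_mpolyX (K : comNzRingType) (n : nat) (s : seq 'I_n) :
  \prod_(j <- s) 'X_j = 'X_[K, \big[mnm_add/0%MM]_(j <- s) U_(j)%MM].
Proof.
elim: s => [|a s IHs]; first by rewrite !big_nil mpolyX0.
by rewrite !big_cons IHs mpolyXD.
Qed.

Lemma mdeg_sum_mnm1 (n : nat) (s : seq 'I_n) :
  mdeg (\big[mnm_add/0%MM]_(j <- s) U_(j)%MM) = size s.
Proof.
elim: s => [|a s IHs]; first by rewrite big_nil mdeg0.
by rewrite big_cons mdegD IHs mdeg1.
Qed.

Section CharacteristicPencil.
Variables (C : closedFieldType) (k n : nat) (B : tensor C k n).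

Definition power_system (r : 'I_n) : {mpoly C[n]} := 'X_r ^+ k.-1.

Definition eigen_system (z : C) (r : 'I_n) : {mpoly C[n]} :=
  z *: 'X_r ^+ k.-1 - \sum_(t : k.-1.-tuple 'I_n) B r t *: \prod_(j <- t) 'X_j.

Lemma power_system_homog r : power_system r \is k.-1.-homog.
Proof.
rewrite -[X in ishomog1 X]mul1n /power_system; apply: dhomogMn.
by rewrite dhomogX /= mdeg1.
Qed.

Lemma eigen_system_homog z r : eigen_system z r \is k.-1.-homog.
Proof.
apply: rpredB; first by apply: dhomogZ; exact: power_system_homog.
apply: rpred_sum => t _; apply: dhomogZ.
by rewrite prod_mpolyX dhomogX /= mdeg_sum_mnm1 size_tuple.
Qed.

Lemma eigen_system_eval z (x : 'rV[C]_n) r :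
  (eigen_system z r).@[fun j => x 0 j] =
  z * x 0 r ^+ k.-1 - tensor_app B x 0 r.
Proof.
rewrite mevalB mevalZ rmorphXn /= mevalXU mxE rmorph_sum /=; congr (_ - _).
apply: eq_bigr => t _; rewrite mevalZ rmorph_prod /=; congr (_ * _).
by apply: eq_bigr => j _; rewrite mevalXU.
Qed.

Lemma eigen_system_zero z (x : 'rV[C]_n) :
  (forall r, (eigen_system z r).@[fun j => x 0 j] = 0) <-> eigen_eq B z x.
Proof.
split=> [Fx|Bx r]; last first.
  by rewrite eigen_system_eval Bx !mxE subrr.
apply/rowP => r; have /eqP := Fx r; rewrite eigen_system_eval subr_eq0 => /eqP <-.
by rewrite !mxE.
Qed.

(** Writing the variable as [z + ('X - z)] turns the characteristic system into a pencil through
    [eigen_system z], the form taken by [resultant_pencil_dvd]. *)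
Lemma coef_char_system z l : coef_at (d := k.-1) (char_system B) l =
  (coef_at (eigen_system z) l)%:P + ('X - z%:P) * (coef_at power_system l)%:P.
Proof.
rewrite /coef_at /char_system /eigen_system /power_system.
set r := (enum_val l).1; set m : 'X_{1..n} := \val _.
(* The ring is arbitrary because these coefficients are needed both over [C] and over [{poly C}]. *)
have coefX (K : comNzRingType) :
    ('X_r ^+ k.-1 : {mpoly K[n]})@_m = (U_(r) *+ k.-1 == m)%MM%:R.
  by rewrite mcoeffXn.
have coefP (K : comNzRingType) (t : k.-1.-tuple 'I_n) :
    (\prod_(j <- t) 'X_j : {mpoly K[n]})@_m =
    (\big[mnm_add/0%MM]_(j <- t) U_(j)%MM == m)%:R.
  by rewrite prod_mpolyX mcoeffX.
have coefS (K : comNzRingType) (b : k.-1.-tuple 'I_n -> K) :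
    (\sum_(t : k.-1.-tuple 'I_n) b t *: \prod_(j <- t) 'X_j : {mpoly K[n]})@_m =
    \sum_(t : k.-1.-tuple 'I_n) b t * (\big[mnm_add/0%MM]_(j <- t) U_(j)%MM == m)%:R.
  by rewrite (raddf_sum (mcoeff m)); apply: eq_bigr => t _ /=; rewrite mcoeffZ coefP.
rewrite !mcoeffB !mcoeffZ !coefX !coefS polyCB polyCM polyC_natr rmorph_sum /=.
rewrite [in RHS](eq_bigr (fun t =>
    (B r t)%:P * (\big[mnm_add/0%MM]_(j <- t) U_(j)%MM == m)%:R)).
  by ring.
by move=> t _; rewrite polyCM polyC_natr.
Qed.

Lemma char_tensor_poly_eval (Res : coef_polynomial C n k.-1) z :
  (char_tensor_poly Res B).[z] = Res.@[coef_at (eigen_system z)].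
Proof.
rewrite horner_mmap; apply: meval_eq => l.
by rewrite (coef_char_system z) !hornerE subrr mul0r addr0.
Qed.
End CharacteristicPencil.

(** * The shift [s I - B] from Z-tensors to nonnegative tensors *)

Definition shift_tensor (K : comNzRingType) (k n : nat) (s : K)
    (B : tensor K k n) : tensor K k n :=
  fun i t => (all (pred1 i) t)%:R * s - B i t.

Lemma shift_tensor_app (K : comNzRingType) (k n : nat) (s : K)
    (B : tensor K k n) (x : 'rV[K]_n) i :
  tensor_app (shift_tensor s B) x 0 i =
  s * x 0 i ^+ k.-1 - tensor_app B x 0 i.
Proof.
rewrite !mxE /shift_tensor; under eq_bigr do rewrite mulrBl -mulrA.
rewrite sumrB; congr (_ - _).
rewrite (eq_bigr (fun t : k.-1.-tuple 'I_n =>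
  ([tuple of nseq k.-1 i] == t)%:R * (s * \prod_(j <- t) x 0 j))) => [|t _].
  by rewrite sum_delta /= big_nseq iter_mulr_1.
by rewrite -val_eqE eq_sym /= (sameP (all_pred1P i t) eqP) size_tuple.
Qed.

Lemma shift_eigen (K : comNzRingType) (k n : nat) (s z : K) (B : tensor K k n)
    (x : 'rV[K]_n) : eigen_eq B z x <-> eigen_eq (shift_tensor s B) (s - z) x.
Proof.
have vec i : vec_pow k x 0 i = x 0 i ^+ k.-1 by rewrite mxE.
split=> Bx; apply/rowP => i.
  by rewrite shift_tensor_app Bx !mxE mulrBl.
have /rowP/(_ i) := Bx; rewrite shift_tensor_app [RHS]mxE vec mulrBl.
move=> /addrI/oppr_inj->.
by rewrite [RHS]mxE vec.
Qed.

Lemma complex_shift (R : realType) (k n : nat) (s : R) (B : tensor R k n) :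
  complex_tensor (shift_tensor s B) =
  shift_tensor (real_complex R s) (complex_tensor B).
Proof.
apply/funext => i; apply/funext => t.
by rewrite /complex_tensor /shift_tensor rmorphB rmorphM rmorph_nat.
Qed.

(** The hypothesis also excludes an infinite [A], which would contain [a + 1] distinct elements. *)
Lemma card_le_of_uniq_seq (T : choiceType) (A : set T) (a : nat) :
  (forall s : seq T, uniq s -> (forall y, y \in s -> A y) -> (size s <= a)%N) ->
  (A #<= `I_a)%card.
Proof.
move=> sA; have [finA|infA] := pselect (finite_set A); last first.
  have [F FA] := infinite_set_fset a.+1 infA.
  by rewrite ltnNge sA // finmap.fset_uniq.
have [m Am] := (finite_setP A).1 finA.
have /andP[Am_le _] : (A #<= `I_m)%card && (`I_m #<= A)%card by rewrite -card_eq_le.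
apply: card_le_trans Am_le _; rewrite card_le_II -(card_fset_set Am).
apply: sA => [|y]; first exact: finmap.fset_uniq.
by rewrite in_fset_set // inE.
Qed.

Section LeastEigenvalue.
Variables (R : realType) (k n : nat) (B : tensor R k n) (lambda : R[i]).
Hypothesis B_Z : Z_tensor B.
Hypothesis B_irr : weakly_irreducible B.
Hypothesis lambda_least : least_H_eigenvalue (complex_tensor B) lambda.
Local Notation toC := (real_complex R).
Local Notation BC := (complex_tensor B).

Lemma dim_gt0 : (0 < n)%N.
Proof.
by have [[x /rV0Pn[[i i_n] _] _] _] := lambda_least; exact: leq_ltn_trans i_n.
Qed.

Lemma Z_tensor_shift : exists s (A : tensor R k n),
  [/\ A = shift_tensor s B, forall i t, 0 <= A i t & weakly_irreducible A].
Proof.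
pose s := \sum_i \sum_t `|B i t|; exists s, (shift_tensor s B); split => //.
  move=> i t; rewrite /shift_tensor; have [_|/B_Z] := boolP (all _ _).
    rewrite mul1r subr_ge0 (le_trans (ler_norm _)) // /s (bigD1 i) //= (bigD1 t) //=.
    by rewrite -addrA lerDl addr_ge0 // sumr_ge0 // => *; rewrite sumr_ge0.
  by rewrite mul0r sub0r oppr_ge0.
move=> i j; apply: connect_sub (B_irr i j) => a b /existsP[t /andP[Bt bt]].
(* The shift may destroy loops, which do not affect connectedness; between distinct vertices the
   entry only changes sign. *)
have [<-|ab] := eqVneq a b; first exact: connect0.
apply: connect1; apply/existsP; exists t; rewrite bt andbT /shift_tensor.
have -> : all (pred1 a) t = false.
  by apply/allPn; exists b => //=; rewrite eq_sym.
by rewrite mul0r sub0r oppr_eq0.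
Qed.

(** The vector [p] is a real eigenvector of [B] for [s - rho], which gives one inequality by
    minimality of [lambda]. Comparing a real eigenvector for [lambda] with [p] gives
    [|s - lambda| <= rho], hence the other. *)
Lemma least_eigenvalue_perron : exists s (A : tensor R k n) rho (p : 'rV[R]_n),
  [/\ A = shift_tensor s B, forall i t, 0 <= A i t, weakly_irreducible A,
      forall i, 0 < p 0 i & eigen_eq A rho p /\ lambda = toC (s - rho)].
Proof.
have [s [A [AE A_ge0 A_irr]]] := Z_tensor_shift.
have [rho [p [p_gt0 Ap]]] := perron_exists A_ge0 A_irr dim_gt0.
exists s, A, rho, p; split => //; split => //.
have [[x x0 Bx] lambda_le] := lambda_least.
have p0 : p != 0.
  by apply/eqP => p0; have := p_gt0 (Ordinal dim_gt0); rewrite p0 mxE ltxx.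
have le1 : lambda <= toC (s - rho).
  apply: lambda_le; exists p => //.
  apply/(shift_eigen (toC s)); rewrite -complex_shift -AE.
  rewrite rmorphB opprB addrC subrK.
  apply/rowP => i; have /rowP/(_ i)/(congr1 toC) := Ap.
  rewrite !mxE rmorphM rmorphXn rmorph_sum /= => <-.
  apply: eq_bigr => t _; rewrite rmorphM rmorph_prod /=; congr (_ * _).
  by apply: eq_bigr => j _; rewrite mxE.
have [y xy y0] := normC_real_row (map_mx toC x).
have Ax : eigen_eq (complex_tensor A) (toC s - lambda) (map_mx toC x).
  by rewrite AE complex_shift; exact: (shift_eigen _ _ _ _).1 Bx.
have xC0 : map_mx toC x != 0 by rewrite map_mx_eq0.
have [le2 _] := complex_eigen_comparison A_ge0 A_irr p_gt0 Ap Ax xC0 xy y0.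
apply/eqP; rewrite eq_le le1 /= rmorphB lerBlDr -lerBlDl.
(* Here [lambda] must be known to be real: it is comparable with the real number [s - rho]. *)
apply: le_trans (real_ler_norm _) le2.
apply: rpredB; first by apply/complex_realP; exists s.
by rewrite (ler_real le1); apply/complex_realP; exists (s - rho).
Qed.
End LeastEigenvalue.

Lemma eigen_eq_scale (K : comNzRingType) (k n : nat) (B : tensor K k n)
    (z c : K) (x : 'rV[K]_n) : eigen_eq B z x -> eigen_eq B z (c *: x).
Proof.
move=> Bx; rewrite /eigen_eq tensor_app_scale Bx; apply/rowP => i.
by rewrite !mxE exprMn mulrCA.
Qed.

Lemma eigenlines_le_alg_mult (R : realType) (k n : nat) (hk : (2 <= k)%N)
    (Res : coef_polynomial R[i] n k.-1) (hRes : is_resultant Res)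
    (B : tensor R k n) (hZ : Z_tensor B) (hirr : weakly_irreducible B)
    (lambda : R[i]) (hlambda : least_H_eigenvalue (complex_tensor B) lambda)
    (m : nat) (L : 'I_m -> {vspace 'rV[R[i]]_n}) :
  injective L ->
  (forall i, proj_eigenvariety (complex_tensor B) lambda (L i)) ->
  (m <= alg_mult Res (complex_tensor B) lambda)%N.
Proof.
move=> L_inj L_eig; set BC := complex_tensor B.
have [_ Res_zero _] := hRes.
have [s [A [rho [p [AE A_ge0 A_irr p_gt0 [Ap lambdaE]]]]]] :=
  least_eigenvalue_perron hZ hirr hlambda.
have AC_eigen z x : eigen_eq BC z x ->
    eigen_eq (complex_tensor A) (real_complex R s - z) x.
  by move=> Bx; rewrite AE complex_shift; exact: (shift_eigen _ _ _ _).1 Bx.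
have s_lambda : real_complex R s - lambda = real_complex R rho.
  by rewrite lambdaE rmorphB opprB addrC subrK.
pose j0 := Ordinal (dim_gt0 hlambda).
have aligned x : eigen_eq BC lambda x -> x != 0 -> (forall i, x 0 i != 0) /\
    (forall i t, complex_tensor A i t * \prod_(j <- t) x 0 j =
     real_complex R (perron_weight A p i t) * x 0 i ^+ k.-1).
  move=> /AC_eigen; rewrite s_lambda => Ax x0.
  exact: (complex_eigenvector_aligned A_ge0 A_irr p_gt0 Ap Ax x0).
(* Eigenvectors have no zero coordinate, so each line has a representative with coordinate 1 at
   [j0]; distinct lines get distinct representatives. *)
have /fin_all_exists[x xE] (i : 'I_m) : exists x : 'rV[R[i]]_n,
    [/\ eigen_eq BC lambda x, x != 0, x 0 j0 = 1 & L i = <[x]>%VS].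
  have [y [By /eqP y0] <-] := L_eig i.
  have [y_neq0 _] := aligned y By y0.
  have c0 : (y 0 j0)^-1 != 0 by rewrite invr_eq0.
  exists ((y 0 j0)^-1 *: y); split.
  - exact: eigen_eq_scale.
  - by rewrite scaler_eq0 negb_or c0.
  - by rewrite mxE mulVf.
  apply/vspaceP => v; apply/vlineP/vlineP => -[c ->].
    by exists (c * y 0 j0); rewrite scalerA mulfK.
  by exists (c / y 0 j0); rewrite scalerA.
have /fin_all_exists[alpha alphaE] (i : 'I_m) : exists alpha : 'I_n -> R[i],
    \sum_r alpha r * x i 0 r ^+ k.-1 = 1 /\
    forall h : 'I_n -> R[i], exists2 w : 'rV[R[i]]_n, w 0 j0 = 0 &
    forall r, exists E : {poly R[i]}, forall s,
      tensor_app (complex_tensor A) (x i + s *: w) 0 r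
        - real_complex R rho * (x i + s *: w) 0 r ^+ k.-1 =
      s * (h r - (\sum_l alpha l * h l) * x i 0 r ^+ k.-1) + s ^+ 2 * E.[s].
  have [Bx x0 _ _] := xE i; have [xi0 xia] := aligned _ Bx x0.
  have [al al1 alt] := perron_tangent A_ge0 A_irr p_gt0 Ap j0 xi0 xia.
  by exists al.
have power_eval (y : 'rV[R[i]]_n) r :
    (power_system R[i] k r).@[fun j => y 0 j] = y 0 r ^+ k.-1.
  by rewrite rmorphXn /= mevalXU.
(* Counting multiplicities requires a nonzero polynomial. It does not vanish at [z = s + rho + 1]:
   an eigenvalue [z] of [B] would give the eigenvalue [-(rho + 1)] of [A], whose modulus exceeds
   [rho]. *)
have phi0 : char_tensor_poly Res BC != 0.
  apply/eqP => phi0; pose z := real_complex R (s + rho + 1).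
  have := char_tensor_poly_eval BC Res z; rewrite phi0 horner0 => /esym Res_z.
  have [y y0 /eigen_system_zero/AC_eigen Ay] :=
    (Res_zero _ (eigen_system_homog BC z)).1 Res_z.
  have [y' yy' y'0] := normC_real_row y.
  have [] := complex_eigen_comparison A_ge0 A_irr p_gt0 Ap Ay y0 yy' y'0.
  rewrite /z -rmorphB /= (_ : s - (s + rho + 1) = - (rho + 1)); last by ring.
  have rho0 : 0 <= rho.
    rewrite -(sum_perron_weight p_gt0 Ap j0) sumr_ge0 // => t _.
    exact: perron_weight_ge0.
  rewrite rmorphN normrN ger0_norm ?ler0c ?addr_ge0 // lecR.
  by rewrite gerDl ler10.
rewrite /alg_mult mup_geq // /char_tensor_poly.
have -> : mmap polyC (coef_at (char_system BC)) Res = mmap polyC (fun l =>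
    (coef_at (d := k.-1) (eigen_system BC lambda) l)%:P
      + ('X - lambda%:P) * (coef_at (@power_system R[i] k n) l)%:P) Res.
  by apply: eq_bigr => mn _; congr (_ * _); apply: mmap1_eq => l;
    exact: coef_char_system.
apply: (@resultant_pencil_dvd R[i] n k.-1 Res _ _ (eigen_system BC lambda)
  (@power_system R[i] k n) _ _ j0 m x _ _ alpha).
- by rewrite -subn1 subn_gt0.
- by move=> F Fd Fx; apply/Res_zero.
- exact: eigen_system_homog.
- exact: power_system_homog.
- by move=> i; have [] := xE i.
- by move=> i j xij; apply: L_inj; have [_ _ _ ->] := xE i; have [_ _ _ ->] := xE j;
    rewrite xij.
- move=> i; have [al1 _] := alphaE i; rewrite -[RHS]al1.
  by apply: eq_bigr => r _; rewrite power_eval.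
move=> i h; have [_ /(_ h) [w w0 wE]] := alphaE i; exists w => // r.
have [E EE] := wE r; exists E => b; rewrite power_eval -EE.
rewrite (meval_eq (v2 := fun j => (x i + b *: w) 0 j)) => [|j]; last by rewrite !mxE.
rewrite eigen_system_eval AE complex_shift shift_tensor_app -s_lambda.
by ring.
Qed.

(** * Irreducible subsets of a finite union of lines *)

Section ZariskiLines.
Variables (C : numClosedFieldType) (n : nat).
Implicit Types (x y : 'rV[C]_n) (Z V : set 'rV[C]_n) (p : {mpoly C[n]}).

Definition line x : set 'rV[C]_n := [set y | y \in <[x]>%VS].

Lemma meval_line0 p x : exists q : {poly C},
  forall c, q.[c] = p.@[fun j => (c *: x) 0 j].
Proof.
have [q qE] := meval_line p (fun=> 0) (fun j => x 0 j).
by exists q => c; rewrite qE; apply: meval_eq => j; rewrite add0r mxE.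
Qed.

Lemma Zariski_closed_point x : Zariski_closed [set x].
Proof.
exists [set p | exists j, p = 'X_j - (x 0 j)%:MP].
apply/seteqP; split=> [_ -> p [j ->]|y Sy].
  by rewrite mevalB mevalXU mevalC subrr.
apply/rowP => j; apply/eqP; rewrite -subr_eq0; apply/eqP.
by rewrite -[RHS](Sy ('X_j - (x 0 j)%:MP)) ?mevalB ?mevalXU ?mevalC //; exists j.
Qed.

Lemma Zariski_closed_line x : x != 0 -> Zariski_closed (line x).
Proof.
move=> /rV0Pn[j0 xj0].
exists [set p | exists j, p = x 0 j0 *: 'X_j - x 0 j *: 'X_j0].
apply/seteqP; split=> [_ /vlineP[c ->] p [j ->]|y Sy].
  by rewrite mevalB !mevalZ !mevalXU !mxE; ring.
apply/vlineP; exists (y 0 j0 / x 0 j0); apply/rowP => j; rewrite mxE.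
have /(Sy _) : exists l, x 0 j0 *: 'X_j - x 0 j *: 'X_j0 =
   x 0 j0 *: 'X_l - x 0 l *: 'X_j0 :> {mpoly C[n]} by exists j.
rewrite mevalB !mevalZ !mevalXU => /eqP; rewrite subr_eq0 => /eqP e.
by apply: (mulfI xj0); rewrite e; field.
Qed.

Lemma Zariski_closed0 : Zariski_closed (set0 : set 'rV[C]_n).
Proof.
exists [set 1]; apply/seteqP; split=> // y /(_ 1 erefl)/eqP.
by rewrite meval1 oner_eq0.
Qed.

Lemma Zariski_closedU V Z :
  Zariski_closed V -> Zariski_closed Z -> Zariski_closed (V `|` Z).
Proof.
move=> [S ->] [T ->]; exists [set p | exists f g, [/\ S f, T g & p = f * g]].
apply/seteqP; split=> [y [Sy|Ty] p [f [g [Sf Tg ->]]]|y STy].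
- by rewrite mevalM (Sy f) ?mul0r.
- by rewrite mevalM (Ty g) ?mulr0.
apply: contrapT => /not_orP[/existsNP[f /not_implyP[Sf /eqP fy]]].
move=> /existsNP[g /not_implyP[Tg /eqP gy]].
have /eqP := STy (f * g) (ex_intro _ f (ex_intro _ g (And3 Sf Tg erefl))).
by rewrite mevalM mulf_eq0 (negPf fy) (negPf gy).
Qed.

(** Irreducibility, stated for two closed sets, extends to finite covers by induction on sublists,
    carrying along that partial unions are closed; the empty cover is excluded since [Z] is
    nonempty. *)
Lemma irreducible_in_cover (I : eqType) (s : seq I) (V : I -> set 'rV[C]_n) Z :
    (forall i, i \in s -> Zariski_closed (V i)) -> irreducible_closed Z ->
    (forall y, Z y -> exists2 i, i \in s & V i y) ->
  exists2 i, i \in s & Z `<=` V i.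
Proof.
move=> Vcl [_ [y0 Zy0] Zirr].
suff : forall s' : seq I, {subset s' <= s} ->
    Zariski_closed [set y | exists2 i, i \in s' & V i y] /\
    (Z `<=` [set y | exists2 i, i \in s' & V i y] ->
     exists2 i, i \in s' & Z `<=` V i).
  by move=> /(_ s (fun _ h => h)) [_ ZV] Zcov; apply: ZV.
elim=> [_|a s' IHs sub].
  split=> [|ZV]; last by have [] := ZV _ Zy0.
  rewrite (_ : [set y | _] = set0); first exact: Zariski_closed0.
  by apply/seteqP; split=> // y [].
have [i si|clV IHV] := IHs; first by apply: sub; rewrite inE si orbT.
have Va : Zariski_closed (V a) by apply/Vcl/sub/mem_head.
have -> : [set y | exists2 i, i \in a :: s' & V i y] =
    V a `|` [set y | exists2 i, i \in s' & V i y].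
  apply/seteqP; split=> [y [l] | y [Vay | [l sl Vly]]].
  - by rewrite inE => /orP[/eqP->|sl] Vly; [left|right; exists l].
  - by exists a => //; exact: mem_head.
  - by exists l => //; rewrite inE sl orbT.
split=> [|/(Zirr _ _ Va clV)[ZVa|/IHV[i si ZVi]]].
- exact: Zariski_closedU.
- by exists a => //; exact: mem_head.
- by exists i => //; rewrite inE si orbT.
Qed.

(** Polynomials restrict to univariate ones on the line, and [{poly C}] is an integral domain. *)
Lemma irreducible_line x : x != 0 -> irreducible_closed (line x).
Proof.
move=> x0; split; first exact: Zariski_closed_line.
  by exists x; exact: memv_line.
move=> V Z [S ->] [T ->] xVZ; apply: contrapT => /not_orP[].
move=> /existsNP[_ /not_implyP[/vlineP[a ->]]] /existsNP[f /not_implyP[Sf /eqP fa]].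
move=> /existsNP[_ /not_implyP[/vlineP[b ->]]] /existsNP[g /not_implyP[Tg /eqP gb]].
have [q qE] := meval_line0 f x; have [r rE] := meval_line0 g x.
have : q * r = 0.
  apply: poly_horner0 => c; rewrite hornerM qE rE.
  have [|Sc|Tc] := xVZ (c *: x); first by apply/vlineP; exists c.
    by rewrite (Sc f) ?mul0r.
  by rewrite (Tc g) ?mulr0.
move=> /eqP; rewrite mulf_eq0 => /orP[/eqP q0|/eqP r0].
  by move: fa; rewrite -qE q0 horner0 eqxx.
by move: gb; rewrite -rE r0 horner0 eqxx.
Qed.

(** Some equation of [Z] is nonzero on the line and has finitely many roots there; irreducibility
    leaves only one of these points. *)
Lemma irreducible_proper_in_line x Z :
  irreducible_closed Z -> Z `<` line x -> exists y, Z = [set y].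
Proof.
move=> Zirr [Zx /existsNP[_ /not_implyP[/vlineP[c ->] Zc]]].
have [[S ZS] [y0 Zy0] _] := Zirr.
move: Zc; rewrite {1}ZS => /existsNP[f /not_implyP[Sf /eqP fc]].
have [q qE] := meval_line0 f x; have [r qr] := closed_field_poly_normal q.
have q0 : q != 0 by apply: contraNneq fc => q0; rewrite -qE q0 horner0.
have [a _ Za] : exists2 a, a \in r & Z `<=` [set a *: x].
  apply: irreducible_in_cover => // [a _|y Zy]; first exact: Zariski_closed_point.
  have /vlineP[b yE] := Zx y Zy; exists b => //.
  have : root q b.
    by rewrite /root qE -yE; move: Zy; rewrite ZS => /(_ f Sf) ->.
  by rewrite qr rootZ ?lead_coef_eq0 // root_prod_XsubC.
exists (a *: x); apply/seteqP; split=> // _ ->.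
by rewrite -(Za _ Zy0).
Qed.

(** In a chain of length 2 the top set lies in one line, so the middle one is a point and the bottom
    one would be empty. If no largest length exists, [variety_dim] takes its default value 0 and the
    bound still holds. *)
Lemma variety_dim_in_lines (s : seq {vspace 'rV[C]_n}) V :
    (forall L, L \in s -> exists2 x, x != 0 & L = <[x]>%VS) ->
    (forall y, V y -> exists2 L : {vspace 'rV[C]_n}, L \in s & y \in L) ->
  (variety_dim V <= 1)%N.
Proof.
move=> s_lines Vs; rewrite /variety_dim.
case: xgetP => [r _ [[Z [Zirr Zlt]] _]|//]; rewrite leqNgt; apply/negP => r2.
have [Z0irr _] := Zirr 0%N isT; have [Z1irr _] := Zirr 1%N (ltnW r2).
have [Z2irr Z2V] := Zirr 2%N r2.
have [L Ls Z2L] : exists2 L : {vspace 'rV[C]_n},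
    L \in s & Z 2%N `<=` [set y | y \in L].
  apply: irreducible_in_cover => // [L /s_lines[x x0 ->]|y Zy].
    exact: Zariski_closed_line.
  exact/Vs/Z2V.
have [x _ LE] := s_lines L Ls; rewrite {}LE in Z2L.
have [Z12 Z21] := Zlt 1%N r2.
have [y Z1y] : exists y, Z 1%N = [set y].
  apply: (irreducible_proper_in_line (x := x)) => //; split.
    exact: subset_trans Z12 Z2L.
  by move=> xZ1; apply: Z21; apply: subset_trans xZ1.
have [Z01 Z10] := Zlt 0%N (ltnW r2); apply: Z10; rewrite Z1y => _ ->.
have [_ [z Zz] _] := Z0irr.
by have := Z01 z Zz; rewrite Z1y => <-.
Qed.
End ZariskiLines.

(** * Counting points and components of the eigenvariety *)

Theorem corollary1p4 (R : realType) (k n : nat) (hk : (2 <= k)%N)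
    (Res : coef_polynomial R[i] n k.-1) (hRes : is_resultant Res)
    (B : tensor R k n) (hZ : Z_tensor B) (hirr : weakly_irreducible B)
    (lambda : R[i])
    (hlambda : least_H_eigenvalue (complex_tensor B) lambda) :
  let BC := complex_tensor B in
  let am := alg_mult Res BC lambda in
  let gm := geom_mult BC lambda in
  [/\ (proj_eigenvariety BC lambda #<= `I_am)%card,
      forall (kappa : nat) (V : 'I_kappa -> set 'rV[R[i]]_n),
        injective V ->
        (forall Z : set 'rV[R[i]]_n,
          irreducible_component (affine_eigenvariety BC lambda) Z <->
          exists i, Z = V i) ->
        (\sum_(i < kappa)
           variety_dim (V i) * k.-1 ^ (variety_dim (V i)).-1 <= am)%N
    & (gm * k.-1 ^ gm.-1 <= am)%N].
Proof.
move=> BC am gm.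
have lines_le := eigenlines_le_alg_mult hk hRes hZ hirr hlambda.
have card_lines : (proj_eigenvariety BC lambda #<= `I_am)%card.
  apply: card_le_of_uniq_seq => s s_uniq s_proj.
  apply: (lines_le _ (tnth (in_tuple s))) => [i j /eqP|i].
    by rewrite !(tnth_nth 0%VS) nth_uniq // => /eqP /val_inj.
  exact/s_proj/mem_tnth.
have [s sE] : exists s : seq {vspace 'rV[R[i]]_n},
    proj_eigenvariety BC lambda = [set` s].
  by apply/finite_seqP/finite_set_leP; exists am.
have s_mem (y : 'rV[R[i]]_n) : affine_eigenvariety BC lambda y ->
    y != 0 -> <[y]>%VS \in s.
  move=> By y0; have : proj_eigenvariety BC lambda <[y]>%VS.
    by exists y => //; split => //; exact/eqP.
  by rewrite sE.
have s_lines L : L \in s -> exists2 x, x != 0 &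
    L = <[x]>%VS /\ affine_eigenvariety BC lambda x.
  move=> Ls; have : proj_eigenvariety BC lambda L by rewrite sE.
  by case=> x [Bx /eqP x0] <-; exists x.
(* One eigenline is needed both to cover the origin and to have [1 <= am]. *)
have [x0 x0_neq0 Bx0] : exists2 x, x != 0 & affine_eigenvariety BC lambda x.
  have [[x x_neq0 Bx] _] := hlambda; exists (map_mx (real_complex R) x) => //.
  by rewrite map_mx_eq0.
have s_cover y : affine_eigenvariety BC lambda y ->
    exists2 L : {vspace 'rV[R[i]]_n}, L \in s & y \in L.
  move=> By; have [->|y0] := eqVneq y 0; last first.
    by exists <[y]>%VS; [exact: s_mem|exact: memv_line].
  by exists <[x0]>%VS; [exact: s_mem|exact: mem0v].
have dim_le1 V : V `<=` affine_eigenvariety BC lambda -> (variety_dim V <= 1)%N.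
  move=> VB; apply: (variety_dim_in_lines (s := s)) => [L|y /VB].
    by move=> /s_lines[x xn0 [LE _]]; exists x.
  exact: s_cover.
(* Dimension 0 contributes 0, and dimension 1 contributes [(k-1)^0 = 1]. *)
have term_le1 V : V `<=` affine_eigenvariety BC lambda ->
    (variety_dim V * k.-1 ^ (variety_dim V).-1 <= 1)%N.
  by move=> /dim_le1; case: (variety_dim V) => [|[|]].
split=> // [kappa V V_inj V_comp|]; last first.
  apply: leq_trans (term_le1 _ (fun _ h => h)) _.
  apply: (lines_le 1%N (fun=> <[x0]>%VS)) => [i j _|_]; first by rewrite !ord1.
  by rewrite sE; exact: s_mem.
have comp i : irreducible_component (affine_eigenvariety BC lambda) (V i).
  by apply/V_comp; exists i.
(* Each component contributes at most 1, so it suffices to match the components with distinct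
   eigenlines. *)
apply: (@leq_trans kappa).
  rewrite -[kappa in X in (_ <= X)%N]card_ord -sum1_card; apply: leq_sum => i _.
  by have [_ Vi _] := comp i; exact: term_le1.
(* A component lies in one line of the list by irreducibility, and equals it by maximality, the line
   being itself irreducible and contained in the eigenvariety. *)
have /fin_all_exists[L LE] (i : 'I_kappa) : exists L : {vspace 'rV[R[i]]_n},
    L \in s /\ V i = [set y | y \in L].
  have [Virr VB Vmax] := comp i.
  have [L Ls VL] : exists2 L : {vspace 'rV[R[i]]_n},
      L \in s & V i `<=` [set y | y \in L].
    apply: irreducible_in_cover => // [L /s_lines[x xn0 [-> _]]|y /VB].
      exact: Zariski_closed_line.
    exact: s_cover.
  exists L; split=> //; apply/esym.
  have [x xn0 [LE Bx]] := s_lines L Ls.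
  apply: Vmax => //; first by rewrite LE; exact: irreducible_line.
  by rewrite LE => _ /vlineP[c ->]; exact: eigen_eq_scale.
apply: (lines_le kappa L) => [i j Lij|i].
  by apply: V_inj; have [_ ->] := LE i; have [_ ->] := LE j; rewrite Lij.
by have [Ls _] := LE i; rewrite sE.
Qed.
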